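(* Let $m\ge2$ and let $\Omega\subset\mathbb{R}^m$ be a body with a piecewise $C^1$ boundary. (1) The $r^{\alpha-m}$-center of $\Omega$ converges to the $r^\infty$-center, i.e. the (unique) min-max point of $\Omega$, as $\alpha\to+\infty$. (2) An asymptotic $r^{-\infty}$-center is an $r^{-\infty}$-center; i.e. the limit of any convergent sequence of $r^{\alpha_i-m}$-centers of $\Omega$ with $\alpha_i\to-\infty$ as $i\to+\infty$ is a max-min point of $\Omega$. In particular, when the max-min point $C_{-\infty}$ of $\Omega$ is unique (and every boundary point of $\Omega$ satisfies the exterior cone condition stated in the context), the sets $\mathcal{C}_{\alpha-m}$ of $r^{\alpha-m}$-centers of $\Omega$ converge to $\{C_{-\infty}\}$ as $\alpha\to-\infty$ with respect to the Hausdorff distance.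
   Context: A body is a compact subset of $\mathbb{R}^m$ that is the closure of its interior. $\mu$ is Lebesgue measure on $\mathbb{R}^m$, $B_\varepsilon(x)$ is the ball with center $x$ and radius $\varepsilon$, $\Omega^c$ is the complement of $\Omega$, and $A(S^{m-1})=2\pi^{m/2}/\Gamma(m/2)$. For $\alpha>0$, $V^{(\alpha)}_\Omega(x)=\int_{\Omega}|x-y|^{\alpha-m}\,d\mu(y)$ for all $x\in\mathbb{R}^m$. For $\alpha<0$ and $x\in\operatorname{int}\Omega$, $$V^{(\alpha)}_\Omega(x)=\lim_{\varepsilon\to+0}\left(\int_{\Omega\setminus B_\varepsilon(x)}|x-y|^{\alpha-m}\,d\mu(y)-\frac{A(S^{m-1})}{-\alpha}\cdot\frac1{\varepsilon^{-\alpha}}\right).$$ For $\alpha>m$ an $r^{\alpha-m}$-center of $\Omega$ is a point at which the minimum value of $V_\Omega^{(\alpha)}$ on $\mathbb{R}^m$ is attained; for $\alpha<0$ it is a point of $\operatorname{int}\Omega$ at which the maximum value of $V_\Omega^{(\alpha)}$ restricted to $\operatorname{int}\Omega$ is attained. (For $\alpha\ge m+1$ the $r^{\alpha-m}$-center is unique.) A min-max point ($r^\infty$-center) of $\Omega$ is a point where the infimum of $\mathbb{R}^m\ni x\mapsto\max_{y\in\Omega}|y-x|$ is attained; it exists and is unique. A max-min point ($r^{-\infty}$-center) of $\Omega$ is a point where the supremum of $\mathbb{R}^m\ni x\mapsto\min_{y\in\overline{\Omega^c}}|y-x|$ is attained. An asymptotic $r^{-\infty}$-center of $\Omega$ is the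 limit of a convergent sequence of $r^{\alpha_i-m}$-centers with $\alpha_i\to-\infty$ as $i\to+\infty$. Exterior cone condition at $z\in\partial\Omega$: there are positive constants $\varepsilon,\theta$ such that $B_\varepsilon(z)\cap\Omega^c$ contains a cone of revolution with vertex $z$ and cone angle $\theta$ (vertex excepted). Under it, $r^{\alpha-m}$-centers exist for all $\alpha\le0$. Hausdorff distance: $d_H(X,Y)=\inf\{\varepsilon>0\mid X\subset(Y)_\varepsilon,\ Y\subset(X)_\varepsilon\}$ with $(X)_\varepsilon=\bigcup_{x\in X}B_\varepsilon(x)$. *)

(* Defs.v *)
From HB Require Import structures.
From mathcomp Require Import all_boot all_order all_algebra.
From mathcomp Require Import all_classical all_reals all_analysis.

Set Implicit Arguments.
Unset Strict Implicit.
Unset Printing Implicit Defensive.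

Import Order.TTheory GRing.Theory Num.Theory.
Import numFieldNormedType.Exports.

Local Open Scope classical_set_scope.
Local Open Scope ring_scope.

(* The n-fold power, on n-tuples, of a sigma-finite measure. *)
Section tuple_measure.
Context {R : realType} {d} {T : measurableType d}.

Definition tuple_cons n (p : T * n.-tuple T) : n.+1.-tuple T :=
  [the n.+1.-tuple T of p.1 :: p.2].

Definition tuple_uncons n (t : n.+1.-tuple T) : T * n.-tuple T :=
  (tnth t ord0, [tuple of behead t]).

Lemma tuple_consK n : cancel (@tuple_cons n) (@tuple_uncons n).
Proof. by move=> [x t]; congr pair; apply/val_inj. Qed.

Lemma measurable_tuple_cons n : measurable_fun setT (@tuple_cons n).
Proof. exact: measurable_cons. Qed.

Lemma measurable_tuple_uncons n : measurable_fun setT (@tuple_uncons n).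
Proof.
apply/measurable_fun_pairP; split; first exact: measurable_tnth.
exact: measurable_behead.
Qed.

Section cons_measure.
Variables (mu : {sigma_finite_measure set T -> \bar R}) (n : nat).
Variable nu : {sigma_finite_measure set (n.-tuple T) -> \bar R}.

Definition cons_measure : set (n.+1.-tuple T) -> \bar R :=
  pushforward (mu \x nu)%E (@tuple_cons n).

HB.instance Definition _ := Measure.copy cons_measure
  (measure_function_pushforward__canonical__measure_function_Measure
    (mu \x nu)%E (@measurable_tuple_cons n)).

Lemma sigma_finite_cons_measure : sigma_finite setT cons_measure.
Proof.
have /sigma_finiteP[F [FT ndF Foo]] := sigma_finiteT mu.
have /sigma_finiteP[G [GT ndG Goo]] := sigma_finiteT nu.
exists (fun k => @tuple_uncons n @^-1` (F k `*` G k)).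
  rewrite -preimage_bigcup (_ : \bigcup_k _ = setT) ?preimage_setT//.
  rewrite -subTset => -[x y] _.
  have [i _ Fx] : (\bigcup_k F k) x by rewrite -FT.
  have [j _ Gy] : (\bigcup_k G k) y by rewrite -GT.
  exists (maxn i j) => //; split.
  - by move: x Fx; exact/subsetPset/ndF/leq_maxl.
  - by move: y Gy; exact/subsetPset/ndG/leq_maxr.
move=> k; have [mF Fk] := Foo k; have [mG Gk] := Goo k; split.
  rewrite -[X in measurable X]setTI; apply: measurable_tuple_uncons => //.
  exact: measurableX.
rewrite /cons_measure /pushforward -comp_preimage.
rewrite (_ : _ \o _ = id); last exact/funext/tuple_consK.
by rewrite product_measure1E// lte_mul_pinfty// ge0_fin_numE.
Qed.

HB.instance Definition _ :=
  Measure_isSigmaFinite.Build _ _ _ cons_measure sigma_finite_cons_measure.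

End cons_measure.

Fixpoint tuple_measure (mu : {sigma_finite_measure set T -> \bar R}) n :
    {sigma_finite_measure set (n.-tuple T) -> \bar R} :=
  if n is k.+1 then cons_measure mu (tuple_measure mu k) else \d_[tuple].

End tuple_measure.

(* Lebesgue measure on R^n, seen on the Borel sets of row vectors. *)
Section lebesgue_measure_rV.
Context {R : realType} (n : nat).
Local Notation T := (measurableTypeR R).

Definition borel_rV := g_sigma_algebraType (@open 'rV[R]_n).

Definition row_of_tuple (t : n.-tuple T) : borel_rV :=
  \row_(i < n) (tnth t i : R).

Lemma measurable_row_of_tuple : measurable_fun setT row_of_tuple.
Proof.
apply: (@measurability _ _ _ borel_rV setT row_of_tuple (@open 'rV[R]_n)) => //.
move=> _ [U oU <-]; rewrite setTI.
pose B (p : 'rV[rat]_n * nat) : set 'rV[R]_n :=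
  ball (map_mx ratr p.1 : 'rV[R]_n) (p.2.+1%:R^-1).
have -> : U = \bigcup_(p in [set p | B p `<=` U]) B p.
  apply/seteqP; split => [x Ux|x [p pU]]; last exact: pU.
  have /nbhs_ballP[e /= e0 xeU] : nbhs x U by exact: open_nbhs_nbhs.
  have [k ke] : exists k : nat, k.+1%:R^-1 < e / 2.
    have [k _ /(_ k (leqnn k)) ?] := near_infty_natSinv_lt (PosNum (divr_gt0 e0 (ltr0Sn R 1))).
    by exists k.
  have k0 : 0 < k.+1%:R^-1 :> R by rewrite invr_gt0.
  have q_ex (i : 'I_n) : exists q : rat, `|x ord0 i - ratr q| < k.+1%:R^-1.
    have [y [+ [q _ qy]]] := @dense_rat R (ball (x ord0 i) k.+1%:R^-1)
      (ex_intro _ _ (ballxx _ k0)) (ball_open _ _).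
    by rewrite -qy; exists q.
  pose q : 'rV[rat]_n := \row_i xget 0 [set q | `|x ord0 i - ratr q| < k.+1%:R^-1].
  have xq : ball (map_mx ratr q : 'rV[R]_n) k.+1%:R^-1 x.
    split=> // i j; rewrite (ord1 i) !mxE.
    have [r /= xr] := q_ex j.
    case: xgetP => [r' -> /=|/(_ r)//]; rewrite /ball/= distrC//.
  exists (q, k) => //= y qy; apply: xeU.
  apply: (@le_ball _ _ _ (k.+1%:R^-1 + k.+1%:R^-1)).
    by rewrite (splitr e) lerD// ltW.
  exact: ball_triangle (ball_sym xq) qy.
rewrite preimage_bigcup bigcup_mkcond; apply: countable_bigcupT_measurable.
  exact: countableP.
move=> [q k]; case: ifP => // _.
have -> : row_of_tuple @^-1` B (q, k) =
    \bigcap_(i in [set: 'I_n]) ((fun t : n.-tuple T => tnth t i) @^-1`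
      ball (ratr (q ord0 i) : R) k.+1%:R^-1).
  apply/seteqP; split => [t [_ qt] i _|t qt]; first by have := qt ord0 i; rewrite !mxE.
  by split=> [|i j]; [rewrite invr_gt0|rewrite (ord1 i) !mxE; exact: qt].
apply: fin_bigcap_measurable => // i _.
rewrite -[X in measurable X]setTI; apply: measurable_tnth => //.
by rewrite ball_itv; exact: measurable_itv.
Qed.

Definition lebesgue_rV : set borel_rV -> \bar R :=
  pushforward (tuple_measure (@lebesgue_measure R) n) row_of_tuple.

HB.instance Definition _ := Measure.copy lebesgue_rV
  (measure_function_pushforward__canonical__measure_function_Measure
    (tuple_measure (@lebesgue_measure R) n) measurable_row_of_tuple).

End lebesgue_measure_rV.

(* The library norm of 'rV[R]_m is the sup norm; it induces the usual topology
   but the metric notions below need the Euclidean one. *)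
Section euclidean.
Context {R : realType} {m : nat}.
Implicit Types x y z : 'rV[R]_m.

Definition dotv x y : R := \sum_(i < m) x ord0 i * y ord0 i.

Definition enorm x : R := Num.sqrt (dotv x x).

Definition eball x (e : R) : set 'rV[R]_m := [set y | enorm (y - x) < e].

Definition thickening (X : set 'rV[R]_m) (e : R) : set 'rV[R]_m :=
  \bigcup_(x in X) eball x e.

(* Extended-real valued: the distance from the empty set to a nonempty set is
   +oo, not the default value 0 of the real-valued infimum. *)
Definition hausdorff_dist (X Y : set 'rV[R]_m) : \bar R :=
  ereal_inf [set e%:E | e in
    [set e | 0 < e /\ X `<=` thickening Y e /\ Y `<=` thickening X e]].

End euclidean.

Section bodies.
Context {R : realType} {m : nat}.
Implicit Types (Omega : set 'rV[R]_m) (x z : 'rV[R]_m).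

Definition is_body Omega :=
  [/\ Omega !=set0, compact Omega & Omega = closure (interior Omega)].

Definition boundary Omega : set 'rV[R]_m := closure Omega `\` interior Omega.

Definition closed_cube k : set 'rV[R]_k :=
  [set u | forall i, 0 <= u ord0 i <= 1].

Definition open_cube k : set 'rV[R]_k :=
  [set u | forall i, 0 < u ord0 i < 1].

(* A C^1 patch: continuously differentiable on a neighbourhood of the closed
   cube, injective and regular on the open cube.  Regularity may fail on the
   faces, so that, e.g., the apex of a circular cone is allowed. *)
Definition C1_patch (phi : 'rV[R]_m.-1 -> 'rV[R]_m) :=
  exists U : set 'rV[R]_m.-1,
    [/\ open U, closed_cube (k := m.-1) `<=` U,
        forall u, U u ->
          differentiable phi u /\ {for u, continuous (jacobian phi)},
        {in open_cube (k := m.-1) &, injective phi} &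
        forall u, open_cube u -> row_free (jacobian phi u)].

(* The boundary is a finite union of C^1 patches, the relative interior of each
   patch being disjoint from all the other patches. *)
Definition piecewise_C1_boundary Omega :=
  exists (N : nat) (phi : 'I_N -> 'rV[R]_m.-1 -> 'rV[R]_m),
    [/\ forall j, C1_patch (phi j),
        boundary Omega =
          \bigcup_(j in [set: 'I_N]) (phi j @` closed_cube (k := m.-1)) &
        forall j l, j != l ->
          phi j @` open_cube (k := m.-1) `&`
          phi l @` closed_cube (k := m.-1) = set0].

(* The solid cone of revolution with vertex z, axis u (a unit vector), aperture
   theta and height h, the vertex being removed. *)
Definition solid_cone z (u : 'rV[R]_m) (theta h : R) : set 'rV[R]_m :=
  [set y | [/\ y != z, dotv (y - z) u <= h &
               enorm (y - z) * cos (theta / 2) <= dotv (y - z) u]].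

Definition exterior_cone_condition Omega z :=
  exists e theta h : R, exists u : 'rV[R]_m,
    [/\ 0 < e, 0 < theta < pi, 0 < h, enorm u = 1 &
        solid_cone z u theta h `<=` eball z e `&` ~` Omega].

End bodies.

Section potentials.
Context {R : realType}.

Definition Gamma (a : R) : R :=
  \int[@lebesgue_measure R]_(t in `]0, +oo[) (t `^ (a - 1) * expR (- t)).

(* The area A(S^(m-1)) of the unit sphere of R^m. *)
Definition sphere_area (m : nat) : R :=
  2 * pi `^ (m%:R / 2) / Gamma (m%:R / 2).

Context {m : nat}.
Implicit Types (Omega : set 'rV[R]_m) (x : 'rV[R]_m) (alpha : R).

Definition riesz_integral alpha (A : set 'rV[R]_m) x : R :=
  \int[@lebesgue_rV R m]_(y in A) (enorm (x - y) `^ (alpha - m%:R)).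

(* Meaningful for 0 < alpha, and for alpha < 0 when x is an interior point of
   Omega; these are the only cases used. *)
Definition potential alpha Omega x : R :=
  if 0 < alpha then riesz_integral alpha Omega x
  else lim ((riesz_integral alpha (Omega `\` eball x e) x
             - sphere_area m / (- alpha) * (1 / e `^ (- alpha)))
            @[e --> 0^'+]).

(* x is an r^(alpha - m)-center of Omega; there is none for 0 <= alpha <= m. *)
Definition is_center alpha Omega x :=
  (m%:R < alpha /\
     forall y, potential alpha Omega x <= potential alpha Omega y) \/
  [/\ alpha < 0, interior Omega x &
     forall y, interior Omega y ->
       potential alpha Omega y <= potential alpha Omega x].

Definition centers alpha Omega : set 'rV[R]_m :=
  [set x | is_center alpha Omega x].

Definition max_dist Omega x : R := sup [set enorm (y - x) | y in Omega].

Definition min_dist_compl Omega x : R :=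
  inf [set enorm (y - x) | y in closure (~` Omega)].

Definition is_minmax_point Omega x :=
  forall y, max_dist Omega x <= max_dist Omega y.

Definition is_maxmin_point Omega x :=
  forall y, min_dist_compl Omega y <= min_dist_compl Omega x.

Definition is_asymptotic_center Omega x :=
  exists (alpha : nat -> R) (c : nat -> 'rV[R]_m),
    [/\ alpha i @[i --> \oo] --> -oo,
        forall i, is_center (alpha i) Omega (c i) &
        c i @[i --> \oo] --> x].

End potentials.

(* Main.v *)
Require Import Defs.
From mathcomp Require Import all_boot all_order all_algebra.
From mathcomp Require Import all_classical all_reals all_analysis.
From mathcomp Require Import measurable_realfun.
From mathcomp Require Import ring lra.

(** The potential of order [alpha] is, up to sign, the power integral of the distance
    over the body ([alpha > m]) or over its complement ([alpha < 0]); as [alpha] tends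
    to [+oo] or [-oo] only the largest, respectively the smallest, of these distances
    matters, so that the extremal points become those of [max_dist] or
    [min_dist_compl].

    Negative orders.  The regularised potential is minus the exterior potential, the
    integral of [enorm (x - y) `^ (alpha - m)] over the complement of the body
    ([potential_exterior]).  This is because the term subtracted in the
    regularisation is the integral of the kernel outside a ball, which is an
    exact identity involving the area of the sphere: it rests on the scaling of
    Lebesgue measure ([eball_volume]), on integration in polar coordinates
    ([integral_shell]) and on the evaluation of the volume of the unit ball through
    the Gaussian integral ([sphere_areaE]).  If [x] is not a max-min point, compare it
    with a point [c] farther from the complement: the exterior potential at [c] is
    smaller than near [x], by a factor of order [1 / - alpha], so that there is no
    center near [x] for very negative [alpha] ([not_maxmin_not_center]).  This proves
    the claim on asymptotic centers, and by compactness of the body all centers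
    approach the max-min point when it is unique.  Centers exist because the exterior
    cone condition makes the exterior potential blow up at the boundary
    ([exterior_potential_blowup], [center_exists]).

    Positive orders.  For [alpha >= m + 1] the kernel is convex in [x], strictly off a
    line, and the potential is large far away; hence there is exactly one center
    ([positive_center_exists], [positive_center_unique]).  Uniqueness of the min-max
    point comes from the parallelogram law ([max_dist_midpoint]).  A point [x] that is
    not min-max sees a ball of the body at distance at least [r] larger than
    [max_dist Omega c] for some [c], so that the ratio of the potentials near [x] and
    at [c] grows exponentially in [alpha] ([not_minmax_not_center]); compactness
    concludes again. *)

Set Implicit Arguments.
Unset Strict Implicit.
Unset Printing Implicit Defensive.

Import Order.TTheory GRing.Theory Num.Theory.
Import numFieldNormedType.Exports.

Local Open Scope classical_set_scope.
Local Open Scope ring_scope.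

(** * Affine images of Lebesgue measure *)

Section affine_change.
Context {R : realType}.
Local Notation T := (measurableTypeR R).
Implicit Types (c b : R).

Definition affine c b : T -> T := fun t => c * t + b.

Lemma measurable_affine c b : measurable_fun setT (affine c b).
Proof.
apply: measurable_funD; last exact: measurable_cst.
by apply: measurable_funM; [exact: measurable_cst|exact: measurable_id].
Qed.

Lemma affine_preimage_itv c b (x y : R) : 0 < c ->
  affine c b @^-1` `]x, y] = `](x - b) / c, (y - b) / c]%classic.
Proof.
move=> c0; apply/seteqP; split => t /=; rewrite /affine !in_itv/= ltr_pdivrMr// ler_pdivlMr//.
  by move=> /andP[xt ty]; apply/andP; split; lra.
by move=> /andP[xt ty]; apply/andP; split; lra.
Qed.

(** Lebesgue measure is determined by its values on half-open intervals, whose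
    preimages under an affine map are computed by [affine_preimage_itv]. *)
Lemma lebesgue_affine c b (A : set T) : 0 < c -> measurable A ->
  (c%:E * @lebesgue_measure R (affine c b @^-1` A) = lebesgue_measure A)%E.
Proof.
move=> c0 mA.
pose nu : {measure set T -> \bar R} :=
  mscale (NngNum (ltW c0)) (measure_function_pushforward__canonical__measure_function_Measure
     lebesgue_measure (measurable_affine c b)).
apply/esym; rewrite (_ : (_ * _)%E = nu A)//.
apply: lebesgue_measure_unique mA => _ [[x y] _ <-].
have -> : nu `]x, y]%classic =
    (c%:E * @lebesgue_measure R (affine c b @^-1` `]x, y]))%E by [].
rewrite affine_preimage_itv// !lebesgue_measure_itv/=.
rewrite !lte_fin ltr_pM2r ?invr_gt0// ltrD2r; case: ifPn => _; last by rewrite mule0.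
by rewrite -!EFinD -EFinM; congr EFin; field; rewrite gt_eqF.
Qed.

Lemma ge0_integral_affine c b (g : T -> \bar R) : 0 < c ->
  measurable_fun setT g -> (forall x, 0 <= g x)%E ->
  (c%:E * \int[@lebesgue_measure R]_x g (affine c b x) =
   \int[@lebesgue_measure R]_x g x)%E.
Proof.
move=> c0 mg g0.
have := @ge0_integral_pushforward _ _ _ _ R _ (measurable_affine c b)
  (@lebesgue_measure R) setT g measurableT mg (fun y _ => g0 y).
rewrite preimage_setT => <-.
pose nu := measure_function_pushforward__canonical__measure_function_Measure
     (@lebesgue_measure R) (measurable_affine c b).
have := @ge0_integral_mscale _ _ R nu setT measurableT (NngNum (ltW c0)) g mg
  (fun x _ => g0 x).
move=> /= <-.
by apply: eq_measure_integral => A mA _; exact: lebesgue_affine.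
Qed.

End affine_change.

Section affine_tuples.
Context {R : realType}.
Local Notation T := (measurableTypeR R).
Local Notation leb := (@lebesgue_measure R).

Definition affine_tuple n (c : R) (b : 'I_n -> R) (t : n.-tuple T) : n.-tuple T :=
  [tuple affine c (b i) (tnth t i) | i < n].

Lemma measurable_affine_tuple n c b : measurable_fun setT (@affine_tuple n c b).
Proof.
apply/measurable_fun_tnthP => i.
rewrite (_ : _ \o _ = affine c (b i) \o (fun t => tnth t i)); last first.
  by apply/funext => t /=; rewrite tnth_mktuple.
by apply: measurableT_comp; [exact: measurable_affine|exact: measurable_tnth].
Qed.

(** Induction on the number of coordinates: the measure of a set is the integral
    of the measures of its sections, to which the induction hypothesis applies,
    and the first coordinate is changed with [ge0_integral_affine]. *)
Lemma tuple_measure_affine n (c : R) b (A : set (n.-tuple T)) :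
  0 < c -> measurable A ->
  ((c ^+ n)%:E * tuple_measure leb n (affine_tuple c b @^-1` A) =
   tuple_measure leb n A)%E.
Proof.
move=> c0; elim: n b A => [|n IH] b A mA.
  rewrite expr0 mul1e /=; congr (\d_ _ _).
  by apply/seteqP; split => t /=; rewrite [affine_tuple _ _ _]tuple0 [t]tuple0.
rewrite /= /cons_measure /pushforward.
set B := @tuple_cons _ _ n @^-1` A.
have mB : measurable B.
  by rewrite -[B]setTI; apply: measurable_tuple_cons.
have -> : @tuple_cons _ _ n @^-1` (affine_tuple c b @^-1` A) =
    (fun p : T * n.-tuple T => (affine c (b ord0) p.1,
       affine_tuple c (fun i => b (lift ord0 i)) p.2)) @^-1` B.
  apply/seteqP; split => -[x t]; rewrite /B /=;
  have -> // : affine_tuple c b (tuple_cons (x, t)) = tuple_cons (affine c (b ord0) x,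
      affine_tuple c (fun i => b (lift ord0 i)) t).
  - apply: eq_from_tnth => i; rewrite !tnth_mktuple /tuple_cons /=.
    case: (unliftP ord0 i) => [j|] ->; last by rewrite !tnth0.
    by rewrite !tnthS tnth_mktuple.
  - apply: eq_from_tnth => i; rewrite !tnth_mktuple /tuple_cons /=.
    case: (unliftP ord0 i) => [j|] ->; last by rewrite !tnth0.
    by rewrite !tnthS tnth_mktuple.
rewrite /product_measure1.
have mg : measurable_fun setT (tuple_measure leb n \o xsection B).
  exact: measurable_fun_xsection.
rewrite exprS EFinM -muleA -ge0_integralZl//; last 2 first.
- apply: measurable_fun_xsection; rewrite -[X in measurable X]setTI.
  have mF : measurable_fun setT (fun p : T * n.-tuple T => (affine c (b ord0) p.1,
       affine_tuple c (fun i => b (lift ord0 i)) p.2)).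
    apply: measurable_fun_pair.
      by apply: measurableT_comp; [exact: measurable_affine|exact: measurable_fst].
    by apply: measurableT_comp; [exact: measurable_affine_tuple|exact: measurable_snd].
  exact: mF.
- by rewrite lee_fin exprn_ge0// ltW.
rewrite -(ge0_integral_affine (b ord0) c0 mg)//; congr (_ * _)%E.
apply: eq_integral => x _ /=.
rewrite -(IH (fun i => b (lift ord0 i)) (xsection B (affine c (b ord0) x))).
  (* The preimage of a section is the section of the preimage, by conversion. *)
  by congr (_ * _)%E; apply: (congr1 (tuple_measure leb n)).
exact: measurable_xsection.
Qed.

End affine_tuples.

(** * Euclidean geometry of row vectors *)

Section euclidean_geometry.
Context {R : realType} {m : nat}.
Implicit Types (x y z : 'rV[R]_m) (r s e : R).

Lemma dotvC x y : dotv x y = dotv y x.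
Proof. by apply: eq_bigr => i _; rewrite mulrC. Qed.

Lemma dotvDl x y z : dotv (x + y) z = dotv x z + dotv y z.
Proof. by rewrite -big_split; apply: eq_bigr => i _; rewrite mxE mulrDl. Qed.

Lemma dotvDr x y z : dotv x (y + z) = dotv x y + dotv x z.
Proof. by rewrite dotvC dotvDl !(dotvC x). Qed.

Lemma dotvZl r x y : dotv (r *: x) y = r * dotv x y.
Proof. by rewrite mulr_sumr; apply: eq_bigr => i _; rewrite mxE mulrA. Qed.

Lemma dotvZr r x y : dotv x (r *: y) = r * dotv x y.
Proof. by rewrite dotvC dotvZl dotvC. Qed.

Lemma dotvNl x y : dotv (- x) y = - dotv x y.
Proof. by rewrite -scaleN1r dotvZl mulN1r. Qed.

Lemma dotvNr x y : dotv x (- y) = - dotv x y.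
Proof. by rewrite dotvC dotvNl dotvC. Qed.

Definition dotvE := (dotvDl, dotvDr, dotvNl, dotvNr, dotvZl, dotvZr).

Lemma dotvv_ge0 x : 0 <= dotv x x.
Proof. by apply: sumr_ge0 => i _; rewrite -expr2 sqr_ge0. Qed.

Lemma enorm_ge0 x : 0 <= enorm x. Proof. exact: sqrtr_ge0. Qed.

Lemma sqr_enorm x : enorm x ^+ 2 = dotv x x.
Proof. by rewrite sqr_sqrtr// dotvv_ge0. Qed.

Lemma coord_le_enorm x i : `|x ord0 i| <= enorm x.
Proof.
rewrite -sqrtr_sqr ler_wsqrtr// /dotv (bigD1 i)//= -expr2 lerDl.
by apply: sumr_ge0 => j _; rewrite -expr2 sqr_ge0.
Qed.

Lemma enorm_eq0 x : enorm x = 0 -> x = 0.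
Proof.
move=> x0; apply/rowP => i; rewrite mxE; apply/eqP; rewrite -normr_eq0 eq_le.
by rewrite normr_ge0 -x0 coord_le_enorm.
Qed.

Lemma enorm0 : enorm (0 : 'rV[R]_m) = 0.
Proof. by rewrite /enorm /dotv big1 ?sqrtr0// => i _; rewrite mxE mul0r. Qed.

Lemma enorm_gt0 x : x != 0 -> 0 < enorm x.
Proof.
by move=> x0; rewrite lt_neqAle enorm_ge0 andbT eq_sym; apply: contra_neq x0 => /enorm_eq0.
Qed.

Lemma enormZ r x : enorm (r *: x) = `|r| * enorm x.
Proof.
by rewrite /enorm dotvZl dotvZr mulrA -expr2 sqrtrM ?sqr_ge0// sqrtr_sqr.
Qed.

Lemma enormN x : enorm (- x) = enorm x.
Proof. by rewrite -scaleN1r enormZ normrN1 mul1r. Qed.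

Lemma enorm_sym x y : enorm (x - y) = enorm (y - x).
Proof. by rewrite -enormN opprB. Qed.

(** The defect in the Cauchy-Schwarz inequality as a square: this gives both the
    inequality and, when the defect vanishes, the parallelism of [x] and [y]. *)
Lemma cauchy_schwarz_defect x y :
  enorm (enorm x *: y - enorm y *: x) ^+ 2 =
  2 * (enorm x * enorm y) * (enorm x * enorm y - dotv x y).
Proof.
rewrite sqr_enorm !dotvE -!sqr_enorm (dotvC y x); ring.
Qed.

Lemma dotv_le_enorm x y : dotv x y <= enorm x * enorm y.
Proof.
have [->|x0] := eqVneq x 0.
  by rewrite enorm0 mul0r /dotv big1// => i _; rewrite mxE mul0r.
have [->|y0] := eqVneq y 0.
  by rewrite enorm0 mulr0 /dotv big1// => i _; rewrite mxE mulr0.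
have := sqr_ge0 (enorm (enorm x *: y - enorm y *: x)).
rewrite cauchy_schwarz_defect pmulr_rge0 ?subr_ge0//.
by rewrite !mulr_gt0// enorm_gt0.
Qed.

Lemma enormD x y : enorm (x + y) <= enorm x + enorm y.
Proof.
rewrite -(@ler_pXn2r _ 2) ?nnegrE ?addr_ge0 ?enorm_ge0//.
rewrite sqrrD !sqr_enorm !dotvE (dotvC y x).
have := dotv_le_enorm x y; lra.
Qed.

Lemma enorm_triangle x y z : enorm (x - z) <= enorm (x - y) + enorm (y - z).
Proof. by apply: le_trans (enormD _ _); rewrite addrA subrK. Qed.

Lemma parallelogram x y z :
  enorm (z - 2^-1 *: (x + y)) ^+ 2 =
  (enorm (z - x) ^+ 2 + enorm (z - y) ^+ 2) / 2 - enorm (x - y) ^+ 2 / 4.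
Proof.
by rewrite !sqr_enorm !dotvE (dotvC y x) (dotvC x z) (dotvC y z); field.
Qed.

Lemma dotv_continuous : continuous (fun x : 'rV[R]_m => dotv x x).
Proof.
apply: continuous_big => [|i _ x]; first exact: add_continuous.
by apply: (@continuousM _ _ (fun x : 'rV[R]_m => x ord0 i) (fun x => x ord0 i));
  exact: coord_continuous.
Qed.

Lemma enorm_continuous : continuous (@enorm R m).
Proof.
move=> x; apply: (@continuous_comp _ _ _ (fun y => dotv y y) Num.sqrt).
  exact: dotv_continuous.
exact: sqrt_continuous.
Qed.

Lemma enormB_continuous z : continuous (fun x : 'rV[R]_m => enorm (x - z)).
Proof.
move=> x; apply: (@continuous_comp _ _ _ (fun y => y - z) (@enorm R m)).
  exact: (@cvgB _ _ _ (nbhs x) _ id (cst z) x z cvg_id (cvg_cst z)).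
exact: enorm_continuous.
Qed.

Lemma open_eball x e : open (eball x e).
Proof.
rewrite (_ : eball x e = (fun y => enorm (y - x)) @^-1` [set t | t < e])//.
apply: open_comp => [y _|]; [exact: enormB_continuous|exact: open_lt].
Qed.

Lemma eball_center x e : 0 < e -> eball x e x.
Proof. by rewrite /eball /= subrr enorm0. Qed.

Lemma eball_nbhs x e : 0 < e -> nbhs x (eball x e).
Proof. by move=> e0; apply: open_nbhs_nbhs; split; [exact: open_eball|exact: eball_center]. Qed.

Lemma nbhs_eballP x (A : set 'rV[R]_m) : nbhs x A -> exists2 e, 0 < e & eball x e `<=` A.
Proof.
move=> /nbhs_ballP[e /= e0 xeA]; exists e => // y xy; apply: xeA; split => // i j.
rewrite /ball /= (ord1 i) distrC; apply: le_lt_trans xy.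
by have := coord_le_enorm (y - x) j; rewrite !mxE.
Qed.

Lemma open_eballP (A : set 'rV[R]_m) x : open A -> A x ->
  exists2 e, 0 < e & eball x e `<=` A.
Proof. by move=> oA Ax; apply: nbhs_eballP; apply: open_nbhs_nbhs. Qed.

Lemma closure_eballP (A : set 'rV[R]_m) x :
  closure A x <-> forall e, 0 < e -> exists2 y, A y & enorm (y - x) < e.
Proof.
split => [clA e e0|H B /nbhs_eballP[e e0 eB]].
  by have [y [Ay xy]] := clA _ (eball_nbhs x e0); exists y.
by have [y Ay yx] := H e e0; exists y; split=> //; exact: eB.
Qed.

Lemma cvg_eballP {T} {F : set_system T} {FF : Filter F} (f : T -> 'rV[R]_m) x :
  (forall e, 0 < e -> \forall t \near F, enorm (f t - x) < e) -> f t @[t --> F] --> x.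
Proof.
move=> H A /nbhs_eballP[e e0 eA].
by apply: filterS (H e e0) => t; exact: eA.
Qed.

Lemma enorm_bounded_set (A : set 'rV[R]_m) M :
  (forall y, A y -> enorm y <= M) -> bounded_set A.
Proof.
move=> AM; exists M; split; first exact: num_real.
move=> N MN y /AM yM; apply: le_trans (ltW MN).
rewrite /Num.norm /= mx_normrE; apply: bigmax_le => [|i _].
  exact: le_trans (enorm_ge0 y) yM.
by rewrite (ord1 i.1); apply: le_trans (coord_le_enorm _ _) yM.
Qed.

Lemma compact_enorm_bounded (K : set 'rV[R]_m) : compact K ->
  exists2 M, 0 < M & forall y, K y -> enorm y <= M.
Proof.
move=> cK.
have : compact ((@enorm R m) @` K).
  apply: continuous_compact cK; exact: continuous_subspaceT enorm_continuous.
move=> /compact_bounded[M [_ HM]]; exists (`|M| + 1); first by rewrite ltr_wpDl.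
move=> y Ky; apply: le_trans (ler_norm _) _; apply: HM; last by exists y.
by rewrite (le_lt_trans (ler_norm M))// ltrDl.
Qed.

Lemma compact_enorm_le M : compact [set x : 'rV[R]_m | enorm x <= M].
Proof.
apply: bounded_closed_compact; first exact: (@enorm_bounded_set _ M).
apply: (@closed_comp _ _ (@enorm R m) [set t | t <= M]); last exact: closed_le.
by move=> x _; exact: enorm_continuous.
Qed.

End euclidean_geometry.

(** * Scaling of balls and the Gaussian integral *)

Section borel_rV.
Context {R : realType} {m : nat}.
Implicit Types (A : set 'rV[R]_m).

Definition borel A := measurable (A : set (@borel_rV R m)).

Lemma open_borel A : open A -> borel A.
Proof. by move=> oA; exact: sub_sigma_algebra. Qed.

Lemma closed_borel A : closed A -> borel A.
Proof.
move=> cA; rewrite /borel -[A]setCK; apply: measurableC.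
by apply: open_borel; exact: closed_openC.
Qed.

Lemma eball_borel (x : 'rV[R]_m) r : borel (eball x r).
Proof. by apply: open_borel; exact: open_eball. Qed.

(** The sigma-algebra on row vectors is generated by the open sets, and that of
    the line by the rays [(a, +oo)], whose preimages are open. *)
Lemma continuous_borel (f : 'rV[R]_m -> R) : continuous f ->
  measurable_fun [set: @borel_rV R m] (f : @borel_rV R m -> R).
Proof.
move=> cf; apply: (measurability _ (RGenOInfty.measurableE R)) => /=.
move=> _ [_ [a ->] <-]; rewrite setTI; apply: open_borel.
rewrite preimage_itvoy (_ : [set x | _] = f @^-1` [set t | a < t])//.
by apply: open_comp => [x _|]; [exact: cf|exact: open_gt].
Qed.

Lemma measurable_enormB (x : 'rV[R]_m) :
  measurable_fun [set: @borel_rV R m] ((fun y => enorm (y - x)) : @borel_rV R m -> R).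
Proof. by apply: continuous_borel; exact: enormB_continuous. Qed.

End borel_rV.

Section ball_volume.
Context {R : realType} {m : nat}.
Local Notation leb := (@lebesgue_measure R).
Local Notation mu := (@lebesgue_rV R m).

Definition unit_ball_volume : \bar R := mu (eball 0 1).

(** The ball [eball x r] is the preimage of the unit ball under [(t - x) / r]. *)
Lemma eball_volume_ereal (x : 'rV[R]_m) r : 0 < r ->
  mu (eball x r) = ((r ^+ m)%:E * unit_ball_volume)%E.
Proof.
move=> r0.
pose b := fun i : 'I_m => - (r^-1 * x ord0 i).
have ri0 : 0 < r^-1 by rewrite invr_gt0.
have mB : measurable (@row_of_tuple R m @^-1` eball 0 1).
  by rewrite -[X in measurable X]setTI; apply: measurable_row_of_tuple => //;
     exact: eball_borel.
have := @tuple_measure_affine R m r^-1 b _ ri0 mB.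
rewrite /unit_ball_volume /lebesgue_rV /pushforward.
have -> : affine_tuple r^-1 b @^-1` (@row_of_tuple R m @^-1` eball 0 1) =
    @row_of_tuple R m @^-1` eball x r.
  have E t : row_of_tuple (affine_tuple r^-1 b t) = r^-1 *: (row_of_tuple t - x).
    by apply/rowP => i; rewrite !mxE tnth_mktuple /affine /b mulrBr ord1.
  by apply/seteqP; split => t; rewrite /eball /= E subr0 enormZ gtr0_norm//
    ltr_pdivrMl// mulr1.
by move=> <-; rewrite muleA -EFinM -exprMn divff ?gt_eqF// expr1n mul1e.
Qed.

End ball_volume.

Section gauss.
Context {R : realType}.
Local Notation T := (measurableTypeR R).
Local Notation leb := (@lebesgue_measure R).

(** The Gaussian is a product of functions of one coordinate, so its integral is
    a product of one-dimensional Gaussian integrals by Tonelli's theorem. *)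
Lemma integral_tuple_gauss n :
  (\int[tuple_measure leb n]_t (expR (- \sum_(i < n) tnth t i ^+ 2))%:E =
   (Num.sqrt pi ^+ n)%:E)%E.
Proof.
have mg k : measurable_fun [set: k.-tuple T]
    (fun t => (expR (- \sum_(i < k) tnth t i ^+ 2))%:E).
  apply/measurable_EFinP; apply: measurableT_comp => //.
  apply: measurableT_comp => //; apply: measurable_sum => i.
  by apply: measurable_funX; exact: measurable_tnth.
elim: n => [|n IH].
  rewrite /= integral_dirac//; last exact: (mg 0%N).
  rewrite expr0 big_ord0 oppr0 expR0 mule1.
  exact: diracT.
rewrite /= /cons_measure.
rewrite (@ge0_integral_pushforward _ _ _ _ R _ (@measurable_tuple_cons _ T n)
  (leb \x tuple_measure leb n)%E setT _ measurableT (mg n.+1)); last first.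
  by move=> y _; rewrite lee_fin expR_ge0.
rewrite preimage_setT fubini_tonelli1//=; last first.
  exact: (measurableT_comp (mg n.+1) (@measurable_tuple_cons _ T n)).
rewrite /fubini_F /=.
transitivity (\int[leb]_x ((Num.sqrt pi ^+ n)%:E * (gauss_fun x)%:E))%E.
  apply: eq_integral => x _.
  transitivity (\int[tuple_measure leb n]_t
      ((gauss_fun x)%:E * (expR (- \sum_(i < n) tnth t i ^+ 2))%:E))%E.
    apply: eq_integral => t _; rewrite big_ord_recl tnth0 opprD expRD EFinM.
    by congr (_ * (expR (- _))%:E)%E; apply: eq_bigr => i _; rewrite tnthS.
  have e0 t : [set: n.-tuple T] t -> (0 <= (expR (- \sum_(i < n) tnth t i ^+ 2))%:E)%E.
    by rewrite lee_fin expR_ge0.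
  rewrite (ge0_integralZl _ measurableT (mg n) e0) ?lee_fin ?gauss_fun_ge0//.
  by rewrite IH muleC.
have mgauss : measurable_fun [set: T] (fun x => (gauss_fun x)%:E).
  by apply/measurable_EFinP; exact: measurable_gauss_fun.
have g0 x : [set: T] x -> (0 <= (gauss_fun x)%:E)%E by rewrite lee_fin gauss_fun_ge0.
have p0 : (0 <= (Num.sqrt pi ^+ n : R)%:E)%E by rewrite lee_fin exprn_ge0// sqrtr_ge0.
rewrite (ge0_integralZl _ measurableT mgauss g0 p0)//.
by rewrite integralT_gauss -EFinM exprSr.
Qed.

Lemma integral_rV_gauss n :
  (\int[@lebesgue_rV R n]_y (expR (- enorm y ^+ 2))%:E = (Num.sqrt pi ^+ n)%:E)%E.
Proof.
rewrite /lebesgue_rV.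
have mf : measurable_fun [set: @borel_rV R n] (fun y : @borel_rV R n => (expR (- enorm y ^+ 2))%:E).
  apply/measurable_EFinP; apply: measurableT_comp => //.
  apply: measurableT_comp => //; apply: measurable_funX.
  by apply: continuous_borel; exact: enorm_continuous.
rewrite (@ge0_integral_pushforward _ _ _ _ R _ (@measurable_row_of_tuple R n)
  (tuple_measure leb n) setT _ measurableT mf); last first.
  by move=> y _; rewrite lee_fin expR_ge0.
rewrite preimage_setT -integral_tuple_gauss; apply: eq_integral => t _ /=.
congr (expR (- _))%:E; rewrite sqr_enorm; apply: eq_bigr => i _.
by rewrite !mxE expr2.
Qed.

End gauss.

(** * Primitives of Stieltjes type *)

Section stieltjes.
Context {R : realType}.
Implicit Types (F phi g : R -> R).

Lemma is_derive_quotient g (r dg : R) : is_derive r 1 g dg <->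
  h^-1 * (g (h + r) - g r) @[h --> 0^'] --> dg.
Proof.
have E : (fun h => h^-1 *: ((g \o shift r) (h *: 1) - g r)) =
         (fun h : R => h^-1 * (g (h + r) - g r)).
  by apply/funext => h /=; rewrite [h *: 1]mulr1.
split => [[dg1 dg2]|H].
  by rewrite -E -dg2; exact: dg1.
split; first by rewrite /derivable E; apply/cvg_ex; exists dg.
by rewrite /derive E; exact/cvg_lim.
Qed.

(** The hypothesis on [F] is what any integral of a nonincreasing [phi] against
    the increments of [g] satisfies.  It places the difference quotient of [F]
    between [phi r] and [phi (h + r)] times that of [g], so the derivative follows
    without any theory of the integral in question. *)
Lemma is_derive_stieltjes F phi g (a r dg : R) : a < r ->
  (forall s t, a < s -> s <= t ->
     phi t * (g t - g s) <= F t - F s <= phi s * (g t - g s)) ->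
  {for r, continuous phi} -> is_derive r 1 g dg -> is_derive r 1 F (phi r * dg).
Proof.
move=> ar H cphi /is_derive_quotient Dg; apply/is_derive_quotient.
set D := fun h : R => h^-1 * (g (h + r) - g r) in Dg.
set q := fun h : R => _.
have cphi' : phi (h + r) @[h --> 0^'] --> phi r.
  exact/continuous_withinNshiftx.
pose E := fun h => `|phi (h + r) - phi r| * `|D h|.
(* Both signs of [h] give the same two-sided bound, with error [E h]. *)
have cE : E h @[h --> 0^'] --> 0.
  suff : E h @[h --> 0^'] --> `|phi r - phi r| * `|dg| by rewrite subrr normr0 mul0r.
  exact: (cvgM (cvg_norm (cvgB cphi' (cvg_cst (phi r)))) (cvg_norm Dg)).
have cL : phi r * D h @[h --> 0^'] --> phi r * dg by exact: (cvgM (cvg_cst _) Dg).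
apply: (@squeeze_cvgr _ _ _ _ (fun h => phi r * D h - E h) (fun h => phi r * D h + E h)).
- have lb : \forall h \near (0:R)^', a < h + r.
    apply: nbhs_dnbhs; exists (r - a) => /=; first by rewrite subr_gt0.
    by move=> h; rewrite /= sub0r normrN ltr_norml => /andP[? _]; lra.
  near=> h.
  have ah : a < h + r by near: h.
  have h0 : h != 0 by near: h; exact: nbhs_dnbhs_neq.
  have : `|q h - phi r * D h| <= E h.
    have Dq : q h - phi r * D h = h^-1 * (F (h + r) - F r - phi r * (g (h + r) - g r)).
      by rewrite /q /D; ring.
    rewrite Dq /E /D normrM [X in _ <= _ * X]normrM mulrCA ler_wpM2l// -normrM.
    have /andP[h1 h2] : phi (h + r) * (g (h + r) - g r) <= F (h + r) - F r <=
        phi r * (g (h + r) - g r).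
      have [hneg|hpos] := leP h 0; last by apply: H => //; lra.
      by have /andP[h1 h2] := H (h + r) r ah ltac:(lra); apply/andP; split; lra.
    rewrite ler0_norm ?subr_le0// ler0_norm; lra.
  by rewrite ler_norml => /andP[? ?]; apply/andP; split; lra.
- suff : (fun h => phi r * D h - E h) @ 0^' --> phi r * dg - 0 by rewrite subr0.
  exact: (cvgB cL cE).
- suff : (fun h => phi r * D h + E h) @ 0^' --> phi r * dg + 0 by rewrite addr0.
  exact: (cvgD cL cE).
Unshelve. all: end_near. Qed.

(** [F] and [H] have the same derivative, hence the same increments. *)
Lemma stieltjes_primitive F phi g (dg : R -> R) (H : R -> R) (c a b : R) :
  c < a -> a <= b ->
  (forall s t, c < s -> s <= t ->
     phi t * (g t - g s) <= F t - F s <= phi s * (g t - g s)) ->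
  (forall r, c < r -> {for r, continuous phi}) ->
  (forall r, c < r -> is_derive r 1 g (dg r)) ->
  (forall r, c < r -> is_derive r 1 H (phi r * dg r)) ->
  F b - F a = H b - H a.
Proof.
move=> ca ab sq cphi Dg DH.
have D0 r : c < r -> is_derive r 1 (F - H) 0.
  move=> cr; rewrite -(subrr (phi r * dg r)); apply: is_deriveB; last exact: DH.
  exact: is_derive_stieltjes cr sq (cphi r cr) (Dg r cr).
have [] := @MVT_segment R (F - H) (fun=> 0) a b ab.
- by move=> r; rewrite in_itv/= => /andP[ar _]; apply: D0; exact: lt_trans ar.
- apply: derivable_within_continuous => r; rewrite in_itv/= => /andP[ar _].
  by have /D0[] : c < r by exact: lt_le_trans ar.
move=> _ _; rewrite mul0r !fctE; lra.
Qed.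

End stieltjes.

(** * Integration in polar coordinates *)

Lemma is_derive_monomial {R : realType} (k r : R) n :
  is_derive r 1 (fun t => k * t ^+ n) (k * (n%:R * r ^+ n.-1)).
Proof.
have D : is_derive r (1 : R) (@GRing.exp R ^~ n) (n%:R * r ^+ n.-1).
  by apply: DeriveDef; [exact: exprn_derivable|rewrite exp_derive [_ *: 1]mulr1].
exact: (@is_deriveZ _ _ _ _ k r 1 _ D).
Qed.

Section shells.
Context {R : realType} {m : nat}.
Local Notation mu := (@lebesgue_rV R m).
Local Notation kappa := (fine (@unit_ball_volume R m)).
Implicit Types (x : 'rV[R]_m) (A : set 'rV[R]_m).

(** The Gaussian is at least [exp (-1)] on the unit ball and has a finite
    integral. *)
Lemma unit_ball_volume_lty : (@unit_ball_volume R m < +oo)%E.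
Proof.
have mf : measurable_fun [set: @borel_rV R m] (fun y : @borel_rV R m => (expR (- enorm y ^+ 2))%:E).
  apply/measurable_EFinP; apply: measurableT_comp => //.
  apply: measurableT_comp => //; apply: measurable_funX.
  by apply: continuous_borel; exact: enorm_continuous.
have mB : borel (eball (0 : 'rV[R]_m) 1) by exact: eball_borel.
have : ((expR (-1))%:E * @unit_ball_volume R m <=
    \int[mu]_y (expR (- enorm y ^+ 2))%:E)%E.
  apply: (@le_trans _ _ (\int[mu]_(y in eball (0 : 'rV[R]_m) 1) (expR (- enorm y ^+ 2))%:E)%E).
    rewrite /unit_ball_volume -integral_cst//; apply: ge0_le_integral => //.
    - by move=> y _; rewrite lee_fin expR_ge0.
    - by apply: measurable_funS mf.
    - move=> y; rewrite /eball /= subr0 => y1; rewrite lee_fin ler_expR lerN2.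
      by rewrite expr_le1// ?enorm_ge0// ltW.
  by apply: ge0_subset_integral => //.
rewrite integral_rV_gauss => H.
rewrite ltey; apply/eqP => E; move: H; rewrite E muleC gt0_mulye ?lte_fin ?expR_gt0//.
Qed.

Lemma unit_ball_volumeE : @unit_ball_volume R m = kappa%:E.
Proof. by rewrite fineK// ge0_fin_numE ?unit_ball_volume_lty// measure_ge0. Qed.

Lemma kappa_ge0 : 0 <= kappa.
Proof. by rewrite fine_ge0// measure_ge0. Qed.

Lemma eball_volume x r : 0 < r -> mu (eball x r) = (kappa * r ^+ m)%:E.
Proof. by move=> r0; rewrite eball_volume_ereal// unit_ball_volumeE -EFinM mulrC. Qed.

Lemma bounded_volume_lty A M : borel A -> (forall y, A y -> enorm y <= M) ->
  (mu A < +oo)%E.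
Proof.
move=> mA AM; apply: (@le_lt_trans _ _ (mu (eball (0 : 'rV[R]_m) (`|M| + 1)))).
  apply: le_measure; rewrite ?inE//; first exact: eball_borel.
  move=> y Ay; rewrite /eball /= subr0; apply: le_lt_trans (AM y Ay) _.
  by rewrite (le_lt_trans (ler_norm M))// ltrDl.
by rewrite eball_volume ?ltry// ltr_wpDl.
Qed.

Definition shell x (a b : R) : set 'rV[R]_m := eball x b `\` eball x a.

Lemma shell_borel x a b : borel (shell x a b).
Proof. by apply: measurableD; exact: eball_borel. Qed.

Lemma shell_volume x a b : 0 < a -> a <= b ->
  mu (shell x a b) = (kappa * b ^+ m - kappa * a ^+ m)%:E.
Proof.
move=> a0 ab; have b0 := lt_le_trans a0 ab.
have bfin : (mu (eball x b) < +oo)%E by rewrite eball_volume ?ltry.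
rewrite (measureD (eball_borel x b) (eball_borel x a) bfin) setIidr; last first.
  by move=> y; rewrite /eball /= => ya; exact: lt_le_trans ab.
by rewrite EFinB; congr (_ - _)%E; exact: eball_volume.
Qed.

Lemma shellU x a b c : a <= b -> b <= c -> shell x a c = shell x a b `|` shell x b c.
Proof.
move=> ab bc; rewrite /shell /eball; apply/seteqP; split => y /=.
  move=> [yc ya]; have [yb|yb] := ltP (enorm (y - x)) b; first by left.
  by right; split => //; apply/negP; rewrite -leNgt.
move=> [[yb ya]|[yc yb]]; split => //; first exact: lt_le_trans bc.
by move=> ya; apply: yb; exact: lt_le_trans ab.
Qed.

Lemma shell_disjoint x a b c : [disjoint shell x a b & shell x b c].
Proof.
by rewrite disj_set2E; apply/eqP/seteqP; split => // y [[yb _] [_ /(_ yb)]].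
Qed.

Section radial.
Variables (phi : R -> R) (x : 'rV[R]_m).
Hypothesis mphi : measurable_fun setT phi.
Hypothesis phi0 : forall r, 0 < r -> 0 <= phi r.
Hypothesis phi_anti : forall s t, 0 < s -> s <= t -> phi t <= phi s.
Hypothesis phi_cont : forall r, 0 < r -> {for r, continuous phi}.
Local Notation f := (fun y : @borel_rV R m => (phi (enorm (y - x)))%:E).

Lemma measurable_radial : measurable_fun [set: @borel_rV R m] f.
Proof.
apply/measurable_EFinP; apply: (measurableT_comp mphi).
exact: measurable_enormB.
Qed.

Let radial_ge0 a b y : 0 < a -> shell x a b y -> (0 <= f y)%E.
Proof.
move=> a0 [_ /negP]; rewrite -leNgt => ay; rewrite lee_fin phi0//.
exact: lt_le_trans ay.
Qed.

Let J a b := (\int[mu]_(y in shell x a b) f y)%E.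

Let J_bounds a b : 0 < a -> a <= b ->
  ((phi b * (kappa * b ^+ m - kappa * a ^+ m))%:E <= J a b <=
   (phi a * (kappa * b ^+ m - kappa * a ^+ m))%:E)%E.
Proof.
move=> a0 ab; have b0 := lt_le_trans a0 ab.
have mf : measurable_fun (shell x a b : set (@borel_rV R m)) f.
  by apply: measurable_funS measurable_radial.
have mS := shell_borel x a b.
rewrite !EFinM -(shell_volume x a0 ab) -!integral_cst//; apply/andP; split.
  apply: ge0_le_integral => //.
  - by move=> y _; rewrite lee_fin phi0.
  - move=> y [yb /negP]; rewrite -leNgt => ay; rewrite lee_fin phi_anti// ?ltW//.
    exact: lt_le_trans ay.
apply: ge0_le_integral => //.
- by move=> y; exact: radial_ge0.
- by move=> y [yb /negP]; rewrite -leNgt => ay; rewrite lee_fin phi_anti.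
Qed.

Let J_fin a b : 0 < a -> a <= b -> J a b \is a fin_num.
Proof.
move=> a0 ab; have /andP[_ Jb] := J_bounds a0 ab.
rewrite ge0_fin_numE; first exact: le_lt_trans Jb (ltry _).
by apply: integral_ge0 => y; exact: radial_ge0.
Qed.

Let J_add a b c : 0 < a -> a <= b -> b <= c -> (J a c = J a b + J b c)%E.
Proof.
move=> a0 ab bc; rewrite /J (shellU x ab bc) ge0_integral_setU//.
- exact: shell_borel.
- exact: shell_borel.
- exact: measurable_funS measurable_radial.
- move=> y [|]; apply: radial_ge0 => //; exact: lt_le_trans ab.
- exact: shell_disjoint.
Qed.

(** Integration in polar coordinates without a measure on the sphere: on a thin
    shell [phi] is squeezed between its values at the two radii, so the integral
    has the increments required by [stieltjes_primitive] with
    [g r = kappa * r ^+ m], the volume of the ball.  The factor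
    [kappa * m * r ^+ m.-1] is the area of the sphere of radius [r]. *)
Lemma integral_shell (H : R -> R) (a b : R) : 0 < a -> a <= b ->
  (forall r : R, 0 < r -> is_derive r 1 H (phi r * (kappa * (m%:R * r ^+ m.-1)))) ->
  (\int[mu]_(y in shell x a b) (phi (enorm (y - x)))%:E = (H b - H a)%:E)%E.
Proof.
move=> a0 ab DH; rewrite -/(J a b).
(* Derivatives are two-sided, so the integral starts strictly before [a]. *)
set c := a / 2; have c0 : 0 < c by rewrite divr_gt0.
have ca : c < a by rewrite /c; lra.
have cpos r : c < r -> 0 < r by exact: lt_trans.
have <- : fine (J c b) - fine (J c a) = H b - H a; last first.
  rewrite (J_add c0 (ltW ca) ab) fineD ?J_fin// ?(ltW ca)//.
  by rewrite addrAC subrr add0r fineK// J_fin.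
apply: (@stieltjes_primitive R (fun t => fine (J c t)) phi
  (fun t => kappa * t ^+ m) (fun r => kappa * (m%:R * r ^+ m.-1)) H c a b) => //.
- move=> s t cs st; have s0 := cpos _ cs.
  rewrite (J_add c0 (ltW cs) st) fineD ?J_fin// ?(ltW cs)//.
  rewrite addrAC subrr add0r -!lee_fin fineK ?J_fin//; exact: J_bounds.
- by move=> r /cpos; exact: phi_cont.
- by move=> r /cpos r0; exact: is_derive_monomial.
- by move=> r /cpos; exact: DH.
Qed.

End radial.
End shells.

(** * Integrals of negative powers outside a ball *)

Section powers.
Context {R : realType}.
Implicit Types (r s t p : R).

Lemma is_derive_powR r p : 0 < r ->
  is_derive r (1 : R) (fun t => t `^ p) (p * r `^ (p - 1)).
Proof.
move=> r0; have r0' : r \in `]0, +oo[%R by rewrite in_itv/= r0.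
apply: DeriveDef; first exact: derivable_powR.
by rewrite -derive1E powR_derive1.
Qed.

Lemma continuous_powR r p : 0 < r -> {for r, continuous (fun t => t `^ p)}.
Proof.
move=> r0; apply/differentiable_continuous/derivable1_diffP.
by have [] := is_derive_powR p r0.
Qed.

Lemma le0_ger_powR s t p : p <= 0 -> 0 < s -> s <= t -> t `^ p <= s `^ p.
Proof.
move=> p0 s0 st; have t0 := lt_le_trans s0 st.
rewrite -[p]opprK (powRN t) (powRN s) lef_pV2 ?posrE ?powR_gt0//.
by apply: ge0_ler_powR => //; rewrite ?nnegrE ?oppr_ge0// ltW.
Qed.

Lemma powR_shift r p (n : nat) : 0 < r -> r `^ (p - n%:R) * r ^+ n = r `^ p.
Proof.
move=> r0; rewrite -powR_mulrn ?ltW// -powRD ?subrK//.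
by apply/implyP => _; rewrite gt_eqF.
Qed.

End powers.

Section power_tail.
Context {R : realType} {m : nat}.
Hypothesis m0 : (0 < m)%N.
Local Notation mu := (@lebesgue_rV R m).
Local Notation kappa := (fine (@unit_ball_volume R m)).
Implicit Types (x : 'rV[R]_m) (alpha : R).

Lemma integral_shell_powR alpha x a b : alpha < 0 -> 0 < a -> a <= b ->
  (\int[mu]_(y in shell x a b) (enorm (y - x) `^ (alpha - m%:R))%:E =
   (kappa * m%:R / - alpha * (a `^ alpha - b `^ alpha))%:E)%E.
Proof.
move=> alpha0 a0 ab; have am0 : alpha - m%:R <= 0 by rewrite subr_le0 (le_trans (ltW alpha0)).
pose H r := (kappa * m%:R / alpha) * r `^ alpha.
rewrite (_ : kappa * m%:R / - alpha * _ = H b - H a); last first.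
  by rewrite /H; field; rewrite lt_eqF.
apply: (@integral_shell R m (fun t => t `^ (alpha - m%:R)) x _ _ _ _ H _ _ a0 ab).
- exact: measurable_powR.
- by move=> r _; exact: powR_ge0.
- by move=> s t s0 st; exact: le0_ger_powR.
- by move=> r; exact: continuous_powR.
- move=> r r0.
  have -> : r `^ (alpha - m%:R) * (kappa * (m%:R * r ^+ m.-1)) =
      (kappa * m%:R / alpha) * (alpha * r `^ (alpha - 1)).
    rewrite -(powR_shift (alpha - 1) m.-1 r0) -addrA -opprD -(natrD _ 1) add1n prednK//.
    by field; rewrite lt_eqF.
  exact: (@is_deriveZ _ _ _ _ _ r 1 _ (is_derive_powR alpha r0)).
Qed.

(** The radii grow geometrically so that their [alpha]-th powers form a geometric
    sequence, whose limit is immediate. *)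
Lemma eball_compl_bigcup x a : 0 < a ->
  ~` eball x a = \bigcup_n shell x a (a * expR n%:R).
Proof.
move=> a0; apply/seteqP; split => [y /= ay|y [n _ []]//].
have [n Hn] : exists n : nat, enorm (y - x) / a < n%:R.
  by exists (Num.truncn (enorm (y - x) / a)).+1; rewrite truncnS_gt.
exists n => //; split => //; rewrite /eball /= mulrC -ltr_pdivrMr//.
apply: lt_le_trans Hn _; apply: le_trans (expR_ge1Dx _); rewrite lerDr//.
Qed.

Lemma integral_tail_powR alpha x a : alpha < 0 -> 0 < a ->
  (\int[mu]_(y in ~` eball x a) (enorm (y - x) `^ (alpha - m%:R))%:E =
   (kappa * m%:R / - alpha * a `^ alpha)%:E)%E.
Proof.
move=> alpha0 a0; rewrite eball_compl_bigcup//.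
pose f (y : @borel_rV R m) := (enorm (y - x) `^ (alpha - m%:R))%:E.
have nd : nondecreasing_seq (fun n => shell x a (a * expR n%:R)).
  move=> i j ij; apply/subsetPset => y [yi ya]; split => //.
  apply: (lt_le_trans yi); rewrite ler_pM2l// ler_expR ler_nat//.
have mf : measurable_fun [set: @borel_rV R m] f.
  by apply: (@measurable_radial _ _ (fun t => t `^ (alpha - m%:R))); exact: measurable_powR.
have C1 := @ge0_nondecreasing_set_cvg_integral _ _ R _ f mu nd
  (fun i => shell_borel x a _) (fun i => measurable_funS measurableT (@subsetT _ _) mf)
  (fun i y _ => powR_ge0 _ _).
apply/esym; apply: cvg_unique C1 => //.
rewrite (_ : (fun _ => _) = fun n : nat => (kappa * m%:R / - alpha *
   (a `^ alpha - a `^ alpha * expR alpha ^+ n))%:E); last first.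
  apply/funext => n; rewrite /f integral_shell_powR//; last first.
    by apply: ler_peMr; [exact: ltW|rewrite -[leLHS]expR0 ler_expR].
  congr (_ * (_ - _))%:E; rewrite powRM ?expR_ge0 ?ltW//; congr (_ * _).
  by rewrite /powR gt_eqF ?expR_gt0// expRK mulrC expRM_natl.
apply: cvg_EFin; first exact: nearW.
have ce : expR alpha ^+ n @[n --> \oo] --> 0.
  apply: cvg_expr; rewrite ger0_norm ?expR_ge0// -[ltRHS]expR0 ltr_expR//.
have : kappa * m%:R / - alpha * (a `^ alpha - a `^ alpha * expR alpha ^+ n) @[n --> \oo]
   --> kappa * m%:R / - alpha * (a `^ alpha - a `^ alpha * 0).
  exact: (cvgM (cvg_cst _) (cvgB (cvg_cst _) (cvgM (cvg_cst _) ce))).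
by rewrite mulr0 subr0.
Qed.

End power_tail.

(** * The area of the sphere *)

Section sphere_area.
Context {R : realType} {m : nat}.
Hypothesis m2 : (2 <= m)%N.
Local Notation mu := (@lebesgue_rV R m).
Local Notation leb := (@lebesgue_measure R).
Local Notation kappa := (fine (@unit_ball_volume R m)).

Implicit Types (a b r s t u : R).

Let p : R := m%:R / 2 - 1.
Let gammaf (t : R) := t `^ p * expR (- t).

Let p0 : 0 <= p.
Proof. by rewrite subr_ge0 ler_pdivlMr// mul1r ler_nat. Qed.

Let gammaf_ge0 t : 0 <= gammaf t.
Proof. by rewrite mulr_ge0 ?powR_ge0 ?expR_ge0. Qed.

Let measurable_gammaf : measurable_fun setT gammaf.
Proof.
apply: measurable_funM; first exact: measurable_powR.
by apply: measurableT_comp => //.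
Qed.

Let continuous_gammaf t : 0 < t -> {for t, continuous gammaf}.
Proof.
move=> t0; apply: (@continuousM _ _ (fun t => t `^ p) (fun t => expR (- t))).
  exact: continuous_powR.
apply: (@continuous_comp _ _ _ -%R expR); first exact: continuousN.
exact: continuous_expR.
Qed.

Let integrable_gammaf u : 0 < u -> leb.-integrable `]0, u] (EFin \o gammaf).
Proof.
move=> u0; apply: measurable_bounded_integrable => //.
- by rewrite /= lebesgue_measure_itv/= lte_fin u0 -EFinD ltry.
- exact: measurable_funS measurable_gammaf.
- exists (u `^ p); split; first exact: num_real.
  move=> M uM t /=; rewrite in_itv/= => /andP[t0 tu].
  rewrite ger0_norm ?gammaf_ge0//; apply: le_trans (ltW uM).
  rewrite -[leRHS]mulr1; apply: ler_pM; rewrite ?powR_ge0 ?expR_ge0//.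
    by apply: ge0_ler_powR => //; rewrite nnegrE ltW// (lt_le_trans t0).
  by rewrite -[leRHS]expR0 ler_expR oppr_le0 ltW.
Qed.

Let G (s : R) := (\int[leb]_(t in `]0, s]) gammaf t)%R.

Let is_derive_G s : 0 < s -> is_derive s (1 : R) G (gammaf s).
Proof.
move=> s0; have s1 : s < s + 1 by rewrite ltrDl.
have sp : 0 < s + 1 by apply: lt_trans s1.
have s0' : (BRight 0 < BRight s)%O by rewrite bnd_simp.
have [] := continuous_FTC1 s1 (integrable_gammaf sp) s0' (continuous_gammaf s0).
by move=> D E; apply: (DeriveDef D); rewrite -derive1E; exact: E.
Qed.

(** The substitution [t = r^2] turns [r^(m-1) exp (- r^2)] into the integrand of
    the Gamma function: both sides have the same derivative in the outer radius. *)
Let integral_shell_gauss a b : 0 < a -> a <= b ->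
  (\int[mu]_(y in shell (0%R : 'rV[R]_m) a b) (expR (- enorm (y - 0) ^+ 2))%:E =
   (kappa * m%:R / 2)%:E * \int[leb]_(t in [set` `]a ^+ 2, b ^+ 2]%R]) (gammaf t)%:E)%E.
Proof.
move=> a0 ab; have b0 := lt_le_trans a0 ab.
have sq0 (r : R) : 0 < r -> 0 < r ^+ 2 by move=> ?; rewrite exprn_gt0.
have -> : (\int[leb]_(t in [set` `]a ^+ 2, b ^+ 2]%R]) (gammaf t)%:E)%E =
    (G (b ^+ 2) - G (a ^+ 2))%:E.
  rewrite /G Rintegral_itvB//; last 3 first.
  - exact/integrable_gammaf/sq0.
  - by rewrite bnd_simp ltW// sq0.
  - by rewrite bnd_simp ler_sqr ?nnegrE// ltW.
  rewrite /Rintegral fineK//; apply: integrable_fin_num => //.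
  apply: (@integrableS _ _ _ leb `]0, b ^+ 2]%classic) => //.
    by apply: subset_itvr; rewrite bnd_simp ltW// sq0.
  by apply: integrable_gammaf; exact: sq0.
pose H r := (kappa * m%:R / 2) * G (r ^+ 2).
rewrite -EFinM (_ : kappa * m%:R / 2 * (G (b ^+ 2) - G (a ^+ 2)) = H b - H a);
  last by rewrite /H -mulrBr.
apply: (@integral_shell R m (fun t => expR (- t ^+ 2)) 0 _ _ _ _ H _ _ a0 ab).
- by apply: measurableT_comp => //; apply: measurableT_comp.
- by move=> r _; exact: expR_ge0.
- by move=> s t s0 st; rewrite ler_expR lerN2 ler_sqr ?nnegrE// ltW// (lt_le_trans s0).
- move=> r _; apply: (@continuous_comp _ _ _ (fun t => - t ^+ 2) expR).
    apply: (@continuous_comp _ _ _ (fun t => t ^+ 2) -%R); last exact: continuousN.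
    exact: exprn_continuous.
  exact: continuous_expR.
- move=> r r0.
  have Dsq : is_derive r (1 : R) (fun t : R => 1 * t ^+ 2) (1 * (2%:R * r ^+ 1)).
    exact: is_derive_monomial.
  have DG : is_derive ((fun t : R => 1 * t ^+ 2) r) 1 G (gammaf (r ^+ 2)).
    by rewrite mul1r; apply: is_derive_G; exact: sq0.
  have := @is_deriveZ _ _ _ _ (kappa * m%:R / 2) r 1 _
    (@is_derive1_comp R G (fun t => 1 * t ^+ 2) r _ _ DG Dsq).
  rewrite (_ : _ \*: _ = H); last first.
    by apply/funext => t; rewrite /H /= mul1r.
  have sqp : (r ^+ 2) `^ p = r ^+ m.-2.
    rewrite -(powR_mulrn 2) ?ltW// -powRrM (_ : 2 * p = m.-2%:R) ?powR_mulrn ?ltW//.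
    by rewrite /p mulrBr mulrCA divff// !mulr1 -(natrB _ m2) subn2.
  congr (is_derive _ _ _ _); rewrite /gammaf sqp.
  have -> : m.-1 = m.-2.+1 by case: (m) m2 => [|[]].
  by rewrite [r ^+ m.-2.+1]exprS /GRing.scale /=; field.
Qed.

Let mu_origin : mu [set 0] = 0%E.
Proof.
apply/eqP; rewrite eq_le measure_ge0 andbT; apply/lee_addgt0Pr => e e0.
rewrite add0e; pose r := Num.min 1 (e / (kappa + 1)).
have k1 : 0 < kappa + 1 by rewrite ltr_wpDl// kappa_ge0.
have r0 : 0 < r by rewrite lt_min ltr01 divr_gt0.
apply: (@le_trans _ _ (mu (eball 0 r))).
  apply: le_measure; rewrite ?inE.
  - apply: closed_borel; apply: compact_closed; last exact: compact_set1.
    exact: norm_hausdorff.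
  - exact: eball_borel.
  - by move=> _ ->; exact: eball_center.
rewrite eball_volume// lee_fin.
apply: (@le_trans _ _ ((kappa + 1) * r)).
  have r1 : r <= 1 by rewrite /r ge_min lexx.
  apply: ler_pM; [exact: kappa_ge0|by rewrite exprn_ge0// ltW|by rewrite lerDl|].
  by rewrite -[leRHS]expr1; exact: (ler_wiXn2l (ltW r0) r1 (ltnW m2)).
by rewrite mulrC -ler_pdivlMr// /r ge_min lexx orbT.
Qed.

(** [integral_shell_gauss] in the limit where the shells exhaust the space without
    its origin, a null set. *)
Lemma gauss_polar : ((Num.sqrt pi ^+ m)%:E =
  (kappa * m%:R / 2)%:E * \int[leb]_(t in `]0%R, +oo[) (t `^ p * expR (- t))%:E)%E.
Proof.
pose a n : R := n.+1%:R^-1; pose b n : R := n.+1%:R.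
have a0 n : 0 < a n by rewrite invr_gt0.
have ab n : a n <= b n.
  by apply: (@le_trans _ _ 1); [rewrite invf_le1// ler1n|rewrite ler1n].
have a_anti i j : (i <= j)%N -> a j <= a i by move=> ij; rewrite lef_pV2 ?posrE// ler_nat.
have b_mono i j : (i <= j)%N -> b i <= b j by move=> ij; rewrite ler_nat.
pose S n := shell (0 : 'rV[R]_m) (a n) (b n).
pose I n : set R := [set` `]a n ^+ 2, b n ^+ 2]].
have ndS : nondecreasing_seq S.
  move=> i j ij; apply/subsetPset => y [yb ya]; split.
    exact: lt_le_trans yb (b_mono _ _ ij).
  by move=> ya'; apply: ya; exact: lt_le_trans ya' (a_anti _ _ ij).
have ndI : nondecreasing_seq I.
  move=> i j ij; apply/subsetPset => t; rewrite /I /= !in_itv/= => /andP[ta tb].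
  apply/andP; split; first by apply: le_lt_trans ta; rewrite ler_sqr ?nnegrE ?(ltW (a0 _))// a_anti.
  by apply: (le_trans tb); rewrite ler_sqr ?nnegrE// b_mono.
have US : \bigcup_n S n = [set~ 0].
  apply/seteqP; split => [y [n _ [_ ya]] /= y0|y /= /eqP y0].
    by apply: ya; rewrite y0; exact: eball_center.
  have y0' := enorm_gt0 y0.
  pose n := maxn (Num.truncn (enorm y)) (Num.truncn (enorm y)^-1).
  have n1 : enorm y < b n.
    by apply: lt_le_trans (truncnS_gt _) _; rewrite ler_nat ltnS leq_maxl.
  have n2 : (enorm y)^-1 < b n.
    by apply: lt_le_trans (truncnS_gt _) _; rewrite ler_nat ltnS leq_maxr.
  exists n => //; split; rewrite /eball /= subr0//; apply/negP; rewrite -leNgt.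
  by rewrite /a invf_ple ?posrE// ltW.
have UI : \bigcup_n I n = `]0, +oo[%classic.
  apply/seteqP; split => [t [n _]|t]; rewrite /I /= !in_itv/= andbT.
    by move=> /andP[ta _]; apply: lt_trans ta; rewrite exprn_gt0.
  move=> t0.
  pose n := maxn (Num.truncn t) (Num.truncn t^-1).
  have n1 : t < b n.
    by apply: lt_le_trans (truncnS_gt _) _; rewrite ler_nat ltnS leq_maxl.
  have n2 : t^-1 < b n.
    by apply: lt_le_trans (truncnS_gt _) _; rewrite ler_nat ltnS leq_maxr.
  have bb : b n <= b n ^+ 2 by rewrite expr2 ler_peMl// ler1n.
  exists n => //=; rewrite in_itv/= (le_trans (ltW n1) bb) andbT.
  rewrite /a exprVn -/(b n) invf_plt ?posrE//; last exact: exprn_gt0.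
  exact: lt_le_trans bb.
pose f (y : @borel_rV R m) := (expR (- enorm (y - 0) ^+ 2))%:E.
pose g (t : measurableTypeR R) := (gammaf t)%:E.
have mf : measurable_fun [set: @borel_rV R m] f.
  apply: (@measurable_radial _ _ (fun t => expR (- t ^+ 2))).
  by apply: measurableT_comp => //; apply: measurableT_comp.
have mg : measurable_fun [set: measurableTypeR R] g by exact/measurable_EFinP.
have f0 y : (0 <= f y)%E by rewrite lee_fin expR_ge0.
have g0 t : (0 <= g t)%E by rewrite lee_fin gammaf_ge0.
have CS := @ge0_nondecreasing_set_cvg_integral _ _ R _ f mu ndS
  (fun i => shell_borel 0 _ _) (fun i => measurable_funS measurableT (@subsetT _ _) mf)
  (fun i y _ => f0 y).
have CI := @ge0_nondecreasing_set_cvg_integral _ (measurableTypeR R) R I g leb ndI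
  (fun i => measurable_itv _) (fun i => measurable_funS measurableT (@subsetT _ _) mg)
  (fun i y _ => g0 y).
transitivity (\int[mu]_(y in \bigcup_n S n) f y)%E.
  have m1 : borel [set (0 : 'rV[R]_m)].
    by apply: closed_borel; apply: compact_closed;
      [exact: norm_hausdorff|exact: compact_set1].
  have := ge0_negligible_integral m1 measurableT mf (fun y _ => f0 y) mu_origin.
  rewrite US setTD => <-; rewrite -integral_rV_gauss.
  by apply: eq_integral => y _; rewrite /f subr0.
rewrite -UI; apply: cvg_unique CS _ => //.
rewrite (_ : (fun _ => _) = fun n => ((kappa * m%:R / 2)%:E * \int[leb]_(t in I n) g t)%E).
  exact: cvgeZl.
by apply/funext => n; exact: integral_shell_gauss.
Qed.

Let sqrt_pi_gt0 : 0 < Num.sqrt pi ^+ m :> R.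
Proof. by rewrite exprn_gt0// sqrtr_gt0 pi_gt0. Qed.

(** Otherwise the Gaussian integral would vanish by [gauss_polar]. *)
Lemma kappa_gt0 : 0 < kappa.
Proof.
rewrite lt_neqAle kappa_ge0 andbT; apply/eqP => k0.
have := gauss_polar; rewrite -k0 !mul0r mul0e => -[] pi0.
by move: sqrt_pi_gt0; rewrite pi0 ltxx.
Qed.

(** The Gaussian integral is [pi^(m/2)], so the constant of the ball volume is
    the area of the sphere divided by the dimension. *)
Lemma sphere_areaE : kappa * m%:R = sphere_area m.
Proof.
have k0 : 0 < kappa * m%:R / 2.
  by rewrite divr_gt0// mulr_gt0 ?kappa_gt0// ltr0n (ltn_trans _ m2).
set I := (\int[leb]_(t in `]0%R, +oo[) (t `^ p * expR (- t))%:E)%E.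
have key : ((Num.sqrt pi ^+ m)%:E = (kappa * m%:R / 2)%:E * I)%E := gauss_polar.
(* [I] is the integral defining [Gamma (m / 2)] *)
have Ifin : I \is a fin_num.
  rewrite ge0_fin_numE; last by apply: integral_ge0 => t _; rewrite lee_fin gammaf_ge0.
  by rewrite ltey; apply/eqP => E; move: key; rewrite E muleC gt0_mulye.
rewrite /sphere_area -[@Gamma R (m%:R / 2)]/(fine I).
have -> : pi `^ (m%:R / 2) = Num.sqrt pi ^+ m :> R.
  by rewrite mulrC powRrM powR12_sqrt ?pi_ge0// powR_mulrn// sqrtr_ge0.
have {}key : Num.sqrt pi ^+ m = (kappa * m%:R / 2) * fine I.
  by apply: EFin_inj; rewrite EFinM fineK.
have I0 : fine I != 0.
  by apply/eqP => I0; move: sqrt_pi_gt0; rewrite key I0 mulr0 ltxx.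
by rewrite key; field.
Qed.

End sphere_area.

(** * The exterior potential *)

Section lower_semicontinuous_minimum.

(** The last hypothesis is lower semicontinuity at the points of [A] together with
    blow-up at the points of [K] outside [A].  If the minimum were not attained,
    each point of [K] would have a neighbourhood whose points in [A] have values
    above some [f a], with [a] in [A]; by compactness one [a] would serve for all
    of [A], including [a] itself. *)
Lemma lsc_attains_min (R : realType) (T : topologicalType) (K A : set T) (f : T -> R) :
  compact K -> A `<=` K -> A !=set0 ->
  (forall x, K x -> forall a, (A x -> a < f x) ->
     \forall x' \near x, A x' -> a < f x') ->
  exists2 x, A x & forall y, A y -> f x <= f y.
Proof.
move=> cK AK [a0 Aa0] lsc; apply: contrapT => nmin.
have step x : A x -> exists2 a, A a & f a < f x.
  move=> Ax; apply: contrapT => H; apply: nmin; exists x => // y Ay.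
  by rewrite leNgt; apply/negP => yx; apply: H; exists y.
pose F := filter_from A (fun a => [set y | f y <= f a]).
have FF : Filter F.
  apply: filter_from_filter; first by exists a0.
  move=> a b Aa Ab; have [ab|ba] := leP (f a) (f b).
    by exists a => // y /= ya; split => //; exact: le_trans ya ab.
  by exists b => // y /= yb; split => //; exact: le_trans yb (ltW ba).
have := (iffLR (compact_near_coveringP K) cK) T F (fun y x => A x -> f y < f x) FF.
case=> [x Kx|a Aa /(_ a (lexx _))]; last first.
  by move=> /(_ a (AK _ Aa) Aa); rewrite ltxx.
have [b Ab bx] : exists2 b, A b & (A x -> f b < f x).
  have [Ax|nAx] := pselect (A x); last by exists a0.
  by have [b Ab bx] := step x Ax; exists b.
near=> x' y => /= Ax'; apply: (@le_lt_trans _ _ (f b)).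
  by near: y; exists b.
by apply: (near (lsc x Kx (f b) bx) x').
Unshelve. all: end_near. Qed.

End lower_semicontinuous_minimum.

Section exterior_potential.
Context {R : realType} {m : nat}.
Hypothesis m2 : (2 <= m)%N.
Local Notation mu := (@lebesgue_rV R m).
Local Notation kappa := (fine (@unit_ball_volume R m)).
Implicit Types (x : 'rV[R]_m) (alpha r : R) (Omega : set 'rV[R]_m).

Lemma measurable_kernel p x :
  measurable_fun [set: @borel_rV R m] (fun y : @borel_rV R m => (enorm (x - y) `^ p)%:E).
Proof.
rewrite (_ : (fun _ => _) = fun y : @borel_rV R m => (enorm (y - x) `^ p)%:E).
  by apply: (@measurable_radial _ _ (fun t => t `^ p)); exact: measurable_powR.
by apply/funext => y; rewrite enorm_sym.
Qed.

Lemma kernel_ge0 p x y : (0 <= (enorm (x - y) `^ p)%:E)%E.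
Proof. by rewrite lee_fin powR_ge0. Qed.

Definition exterior_potential alpha Omega x : \bar R :=
  (\int[mu]_(y in ~` Omega) (enorm (x - y) `^ (alpha - m%:R))%:E)%E.

Lemma integral_tail_kernel alpha x r : alpha < 0 -> 0 < r ->
  (\int[mu]_(y in ~` eball x r) (enorm (x - y) `^ (alpha - m%:R))%:E =
   (sphere_area m / - alpha * r `^ alpha)%:E)%E.
Proof.
move=> alpha0 r0; rewrite -sphere_areaE// -(integral_tail_powR (ltnW m2) x alpha0 r0).
by apply: eq_integral => y _; rewrite enorm_sym.
Qed.

Lemma exterior_potential_le alpha Omega x r : closed Omega -> alpha < 0 -> 0 < r ->
  eball x r `<=` Omega ->
  (exterior_potential alpha Omega x <= (sphere_area m / - alpha * r `^ alpha)%:E)%E.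
Proof.
move=> cO alpha0 r0 xr; rewrite -(integral_tail_kernel x)//.
apply: ge0_subset_integral.
- by apply: measurableC; exact: closed_borel.
- by apply: measurableC; exact: eball_borel.
- exact: measurable_funS (measurable_kernel _ _).
- by move=> y _; exact: kernel_ge0.
- exact: subsetC.
Qed.

Lemma exterior_potential_fin alpha Omega x : closed Omega -> alpha < 0 ->
  interior Omega x -> exterior_potential alpha Omega x \is a fin_num.
Proof.
move=> cO alpha0 /nbhs_eballP[r r0 xr]; rewrite ge0_fin_numE.
  exact: le_lt_trans (exterior_potential_le cO alpha0 r0 xr) (ltry _).
by apply: integral_ge0 => y _; exact: kernel_ge0.
Qed.

(** Only the contribution of a ball of the complement is kept. *)
Lemma exterior_potential_ge alpha Omega x w eta r : closed Omega ->
  alpha < 0 -> Omega x -> 0 < eta -> eball w eta `<=` ~` Omega ->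
  (forall y, eball w eta y -> enorm (x - y) <= r) ->
  ((r `^ (alpha - m%:R) * (kappa * eta ^+ m))%:E <= exterior_potential alpha Omega x)%E.
Proof.
move=> cO alpha0 Ox eta0 wO wr.
have mB := eball_borel w eta.
apply: (@le_trans _ _ (\int[mu]_(y in eball w eta) (enorm (x - y) `^ (alpha - m%:R))%:E)%E).
  rewrite EFinM -(eball_volume w eta0) -integral_cst//; apply: ge0_le_integral => //.
  - by move=> y _; rewrite lee_fin powR_ge0.
  - exact: measurable_funS (measurable_kernel _ _).
  move=> y wy; rewrite lee_fin; apply: le0_ger_powR.
  - by rewrite subr_le0 (le_trans (ltW alpha0)).
  - by apply: enorm_gt0; rewrite subr_eq0; apply/eqP => xy; apply: (wO y wy); rewrite -xy.
  - exact: wr.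
apply: ge0_subset_integral => //.
- by apply: measurableC; exact: closed_borel.
- exact: measurable_funS (measurable_kernel _ _).
- by move=> y _; exact: kernel_ge0.
Qed.

(** The term subtracted in the regularisation is the integral of the kernel over
    the complement of the small ball, by [integral_tail_kernel]; what remains is
    minus the integral over the complement of the body, for every small radius. *)
Lemma potential_exterior alpha Omega x : closed Omega -> alpha < 0 ->
  interior Omega x -> potential alpha Omega x = - fine (exterior_potential alpha Omega x).
Proof.
move=> cO alpha0 xO; have Wfin := exterior_potential_fin cO alpha0 xO.
have [d d0 dO] := nbhs_eballP xO.
rewrite /potential ltNge (ltW alpha0) /=.
apply: lim_near_cst => //; near=> e.
have e0 : 0 < e by near: e; exact: nbhs_right_gt.
have ed : e < d by near: e; exact: nbhs_right_lt.
have eO : eball x e `<=` Omega.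
  by move=> y ye; apply: dO; exact: lt_trans ye ed.
have split_tail : ((sphere_area m / - alpha * e `^ alpha)%:E =
    \int[mu]_(y in Omega `\` eball x e) (enorm (x - y) `^ (alpha - m%:R))%:E +
    exterior_potential alpha Omega x)%E.
  rewrite -(integral_tail_kernel x)// /exterior_potential.
  have -> : ~` eball x e = (Omega `\` eball x e) `|` ~` Omega.
    apply/seteqP; split => [y ye|y [[]//|yO ye]]; last exact/yO/eO.
    by have [yO|yO] := pselect (Omega y); [left|right].
  apply: ge0_integral_setU.
  - by apply: measurableD; [exact: closed_borel|exact: eball_borel].
  - by apply: measurableC; exact: closed_borel.
  - exact: measurable_funS (measurable_kernel _ _).
  - by move=> y _; exact: kernel_ge0.
  - by rewrite disj_set2E; apply/eqP/seteqP; split => // y [[]].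
have riesz : riesz_integral alpha (Omega `\` eball x e) x =
    sphere_area m / - alpha * e `^ alpha - fine (exterior_potential alpha Omega x).
  rewrite /riesz_integral /Rintegral.
  rewrite -[sphere_area m / _ * _]/(fine (sphere_area m / - alpha * e `^ alpha)%:E).
  by rewrite -fineB// split_tail addeK.
by rewrite riesz powRN invrK; ring.
Unshelve. all: end_near. Qed.

End exterior_potential.

(** * Asymptotic centers are max-min points *)

Section distance_to_complement.
Context {R : realType} {m : nat}.
Hypothesis m0 : (0 < m)%N.
Implicit Types (x y z : 'rV[R]_m) (Omega : set 'rV[R]_m) (e r : R).

(** A bounded set misses far away points; at least one coordinate is needed. *)
Lemma closure_compl_nonempty Omega : compact Omega -> closure (~` Omega) !=set0.
Proof.
move=> /compact_enorm_bounded[M M0 OM].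
pose y : 'rV[R]_m := const_mx (M + 1); exists y; apply: subset_closure => /OM.
apply/negP; rewrite -ltNge; apply: lt_le_trans (coord_le_enorm y (Ordinal m0)).
by rewrite mxE ger0_norm ?ltrDl// addr_ge0// ltW.
Qed.

Variable Omega : set 'rV[R]_m.
Hypothesis cO : compact Omega.
Local Notation rho := (min_dist_compl Omega).

Let has_inf_dist x : has_inf [set enorm (y - x) | y in closure (~` Omega)].
Proof.
split; last by exists 0 => _ [y _ <-]; exact: enorm_ge0.
by have [y yO] := closure_compl_nonempty cO; exists (enorm (y - x)), y.
Qed.

Lemma min_dist_compl_le x y : closure (~` Omega) y -> rho x <= enorm (y - x).
Proof. by move=> yO; apply: (ge_inf (has_inf_dist x).2); exists y. Qed.

Lemma min_dist_compl_ge0 x : 0 <= rho x.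
Proof.
by apply: lb_le_inf; [exact: (has_inf_dist x).1|move=> _ [y _ <-]; exact: enorm_ge0].
Qed.

Lemma min_dist_compl_lt x r : rho x < r -> exists2 w, ~ Omega w & enorm (w - x) < r.
Proof.
move=> xr; have [_ [z zO <-] zr] := inf_lt (has_inf_dist x).1 xr.
have r0 : 0 < r - enorm (z - x) by rewrite subr_gt0.
have [w wO wz] := (closure_eballP (~` Omega) z).1 zO _ r0.
by exists w => //; apply: le_lt_trans (enorm_triangle w z x) _; rewrite -ltrBrDr.
Qed.

Lemma eball_min_dist_compl x : eball x (rho x) `<=` Omega.
Proof.
move=> y yx; apply: contrapT => yO.
by move: yx; rewrite /eball /= ltNge min_dist_compl_le//; exact: subset_closure.
Qed.

Lemma min_dist_compl_interior x : 0 < rho x -> interior Omega x.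
Proof.
move=> x0; apply: (@filterS _ _ _ (eball x (rho x))) => //.
  exact: eball_min_dist_compl.
exact: eball_nbhs.
Qed.

End distance_to_complement.

Section negative_order.
Context {R : realType} {m : nat}.
Hypothesis m2 : (2 <= m)%N.
Local Notation mu := (@lebesgue_rV R m).
Local Notation kappa := (fine (@unit_ball_volume R m)).
Implicit Types (x y z c : 'rV[R]_m) (alpha r a : R).
Variable Omega : set 'rV[R]_m.
Hypothesis cO : compact Omega.
Local Notation rho := (min_dist_compl Omega).
Local Notation W := (exterior_potential (m := m)).

Let clO : closed Omega.
Proof. by apply: compact_closed cO; exact: norm_hausdorff. Qed.

Let m0 : (0 < m)%N := ltnW m2.

(** If [c] is a point with [rho x < rho c], some ball of the complement stays within
    distance [rho c] of every point near [x].  There the exterior potential is at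
    least a constant times [(rho c)^alpha], while at [c] it is at most
    [(rho c)^alpha] times [sphere_area m / - alpha], which tends to 0.  The
    exclusion is uniform near [x], so that it can be used both along a sequence and
    on a compact set. *)
Lemma not_maxmin_not_center x : ~ is_maxmin_point Omega x ->
  \forall x' \near x & alpha \near -oo, ~ is_center alpha Omega x'.
Proof.
move=> /existsNP[c /negP]; rewrite -ltNge => xc.
have c0 : 0 < rho c := le_lt_trans (min_dist_compl_ge0 m0 cO x) xc.
(* Four margins of size [q]: one for the moving point, one for the radius of the
   ball, two for the position of its center. *)
pose q := (rho c - rho x) / 4.
have q0 : 0 < q by rewrite divr_gt0// subr_gt0.
have [w wO wx] : exists2 w, ~ Omega w & enorm (w - x) < rho x + 2 * q.
  by apply: min_dist_compl_lt => //; rewrite ltrDl mulr_gt0.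
have [eta' eta'0 wO'] := open_eballP (closed_openC clO) wO.
pose eta := Num.min eta' q.
have eta0 : 0 < eta by rewrite lt_min eta'0.
have wOeta : eball w eta `<=` ~` Omega.
  by move=> y wy; apply: wO'; apply: lt_le_trans wy _; rewrite /eta ge_min lexx.
pose D : R := kappa * eta ^+ m / rho c ^+ m.
have D0 : 0 < D by rewrite !mulr_gt0 ?kappa_gt0 ?invr_gt0 ?exprn_gt0.
near=> x' alpha => isc.
have alpha0 : alpha < 0 by near: alpha; exact: nbhs_ninfty_lt.
have alphaD : sphere_area m / D < - alpha.
  by rewrite ltrNr; near: alpha; apply: nbhs_ninfty_lt; exact: num_real.
have x'x : enorm (x' - x) < q by near: x'; exact: eball_nbhs.
case: isc => [[malpha _]|[_ x'O cmax]].
  by move: (lt_trans malpha alpha0); rewrite ltNge ler0n.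
have cI := min_dist_compl_interior m0 cO c0.
have Wle := exterior_potential_le m2 clO alpha0 c0 (eball_min_dist_compl m0 cO (x := c)).
have Wge : ((rho c `^ (alpha - m%:R) * (kappa * eta ^+ m))%:E <= W alpha Omega x')%E.
  have x'O' : Omega x' := interior_subset x'O.
  apply: (exterior_potential_ge clO alpha0 x'O' eta0 wOeta).
  move=> y wy; have wyq : enorm (y - w) < q.
    by apply: lt_le_trans wy _; rewrite /eta ge_min lexx orbT.
  have := enorm_triangle x' x y; have := enorm_triangle x w y.
  rewrite (enorm_sym x w) (enorm_sym w y) /q in wx wyq x'x *; lra.
have := cmax c cI; rewrite !potential_exterior// lerN2 => Wcx.
have : rho c `^ (alpha - m%:R) * (kappa * eta ^+ m) <= sphere_area m / - alpha * rho c `^ alpha.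
  apply: (@le_trans _ _ (fine (W alpha Omega x'))).
    by rewrite -lee_fin fineK// exterior_potential_fin.
  apply: le_trans Wcx _.
  by rewrite -lee_fin fineK// exterior_potential_fin.
apply/negP; rewrite -ltNge.
have -> : rho c `^ (alpha - m%:R) * (kappa * eta ^+ m) = D * rho c `^ alpha.
  rewrite -(powR_shift alpha m c0) /D; field.
  by rewrite expf_neq0// gt_eqF.
rewrite ltr_pM2r ?powR_gt0// ltr_pdivrMr ?oppr_gt0//.
by rewrite mulrC -ltr_pdivrMr.
Unshelve. all: end_near. Qed.

Lemma asymptotic_center_maxmin x : is_asymptotic_center Omega x -> is_maxmin_point Omega x.
Proof.
move=> [alpha [c [alphaoo cc cx]]]; apply: contrapT => /not_maxmin_not_center.
case=> -[/= U V] [Ux Voo] UV.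
have [i _ [Ui Vi]] : exists2 i : nat, True & U (c i) /\ V (alpha i).
  have : \forall i \near \oo, U (c i) /\ V (alpha i).
    by near=> i; split; [near: i; exact: cx|near: i; exact: alphaoo].
  by move=> [N _ HN]; exists N => //; apply: HN => /=.
by apply: (UV (c i, alpha i)) (cc i).
Unshelve. all: end_near. Qed.

End negative_order.

(** * Centers of negative order *)

Section existence_negative.
Context {R : realType} {m : nat}.
Hypothesis m2 : (2 <= m)%N.
Local Notation mu := (@lebesgue_rV R m).
Local Notation kappa := (fine (@unit_ball_volume R m)).
Implicit Types (x y z c u : 'rV[R]_m) (alpha r a d : R).
Variable Omega : set 'rV[R]_m.
Hypothesis cO : compact Omega.
Local Notation W := (exterior_potential (m := m)).

Let clO : closed Omega.
Proof. by apply: compact_closed cO; exact: norm_hausdorff. Qed.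

(** Moving [x] by [d] inside a ball of radius [r] of [Omega] stretches its
    distances to the complement, all at least [r], by a factor at most [1 + d / r].
    This gives lower semicontinuity without a convergence theorem. *)
Lemma exterior_potential_harnack alpha x x' r : alpha < 0 -> 0 < r ->
  eball x r `<=` Omega -> eball x r x' ->
  (((1 + enorm (x' - x) / r) `^ (alpha - m%:R))%:E * W alpha Omega x <=
   W alpha Omega x')%E.
Proof.
move=> alpha0 r0 xr x'r.
have p0 : alpha - m%:R <= 0 by rewrite subr_le0 (le_trans (ltW alpha0)).
have t0 : 0 <= enorm (x' - x) / r by rewrite divr_ge0// ?enorm_ge0// ltW.
have mC : borel (~` Omega) by apply: measurableC; exact: closed_borel.
rewrite /exterior_potential -ge0_integralZl//.
- apply: ge0_le_integral => //.
  + by move=> y _; rewrite mule_ge0// lee_fin powR_ge0.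
  + apply: measurable_funeM; exact: measurable_funS (measurable_kernel _ _).
  + exact: measurable_funS (measurable_kernel _ _).
  move=> y yO; rewrite -EFinM lee_fin -powRM ?enorm_ge0 ?addr_ge0//.
  have x'y : x' <> y by move=> x'y; apply: yO; rewrite -x'y; exact: xr.
  apply: le0_ger_powR => //.
    by apply: enorm_gt0; rewrite subr_eq0; apply/eqP.
  have ry : r <= enorm (x - y).
    by rewrite leNgt enorm_sym; apply/negP => yx; exact/yO/xr.
  have := enorm_triangle x' x y.
  have : enorm (x' - x) <= enorm (x' - x) / r * enorm (x - y).
    by rewrite mulrAC -mulrA ler_peMr ?enorm_ge0// ler_pdivlMr// mul1r.
  lra.
- exact: measurable_funS (measurable_kernel _ _).
- by move=> y _; exact: kernel_ge0.
- by rewrite lee_fin powR_ge0.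
Qed.

Lemma exterior_potential_lsc alpha x a : alpha < 0 -> interior Omega x ->
  a < fine (W alpha Omega x) -> \forall x' \near x, a < fine (W alpha Omega x').
Proof.
move=> alpha0 xO aW; have [r r0 xr] := nbhs_eballP xO.
pose g x' := (1 + enorm (x' - x) / r) `^ (alpha - m%:R) * fine (W alpha Omega x).
have gx : g x' @[x' --> x] --> g x.
  have c1 : 1 + enorm (x' - x) / r @[x' --> x] --> 1 + enorm (x - x) / r.
    have c0 : enorm (x' - x) @[x' --> x] --> enorm (x - x) := @enormB_continuous _ _ x x.
    exact: (cvgD (cvg_cst _) (cvgM c0 (cvg_cst _))).
  have c2 : {for 1 + enorm (x - x) / r, continuous (fun t => t `^ (alpha - m%:R))}.
    by apply: continuous_powR; rewrite subrr enorm0 mul0r addr0.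
  exact: (cvgM (cvg_comp _ _ c1 c2) (cvg_cst _)).
have ag : a < g x by rewrite /g subrr enorm0 mul0r addr0 powR1 mul1r.
near=> x'.
have x'r : eball x r x' by near: x'; exact: eball_nbhs.
have x'O : interior Omega x'.
  by apply: (@filterS _ _ _ (eball x r)) => //; apply: open_nbhs_nbhs; split => //; exact: open_eball.
apply: (@lt_le_trans _ _ (g x')).
  by near: x'; exact: (cvgr_gt (g x) gx).
have := exterior_potential_harnack alpha0 r0 xr x'r.
rewrite -(fineK (exterior_potential_fin m2 clO alpha0 xO)).
by rewrite -(fineK (exterior_potential_fin m2 clO alpha0 x'O)) -EFinM lee_fin.
Unshelve. all: end_near. Qed.

(** A cone is invariant under dilations about its vertex, so that it contains balls
    at all small scales [d], with a fixed ratio [k] of radius to distance. *)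
Lemma cone_balls z u (theta h : R) : 0 < theta < pi -> enorm u = 1 ->
  exists2 k, 0 < k < 1 & forall d, 0 < d -> 2 * d <= h ->
    eball (z + d *: u) (k * d) `<=` solid_cone z u theta h.
Proof.
move=> /andP[th0 thpi] u1.
set s := cos (theta / 2).
have s0 : 0 < s.
  apply: cos_gt0_pihalf; apply/andP; split.
    by apply: (@lt_trans _ _ 0); rewrite ?oppr_lt0 divr_gt0// pi_gt0.
  by rewrite ltr_pM2r.
have s1 : s < 1.
  rewrite /s -[ltRHS]cos0 ltr_cos ?in_itv/= ?lexx ?pi_ge0 ?divr_gt0//.
  rewrite divr_ge0 ?(ltW th0)//= ler_pdivrMr// (le_trans (ltW thpi))//.
  by rewrite ler_peMr ?pi_ge0// ler1n.
(* The ratio for which the worst point of the ball, of norm [(1 + k) d] and height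
   [(1 - k) d], just satisfies the angle condition. *)
pose k := (1 - s) / (1 + s).
have k0 : 0 < k by rewrite divr_gt0// ?subr_gt0// addr_gt0.
have k1 : k < 1 by rewrite ltr_pdivrMr ?addr_gt0//; lra.
have ks : (1 + k) * s = 1 - k by rewrite /k; field; rewrite gt_eqF// addr_gt0.
exists k; first by rewrite k0.
move=> d d0 dh y; rewrite /eball /= => yw.
set w := y - (z + d *: u) in yw.
have yzE : y - z = d *: u + w by apply/rowP => i; rewrite /w !mxE; ring.
have uu : dotv u u = 1 by rewrite -sqr_enorm u1 expr1n.
have wu1 : dotv w u <= enorm w by have := dotv_le_enorm w u; rewrite u1 mulr1.
have wu2 : - enorm w <= dotv w u.
  by have := dotv_le_enorm (- w) u; rewrite dotvNl enormN u1 mulr1; lra.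
have dotE : dotv (y - z) u = d + dotv w u by rewrite yzE dotvDl dotvZl uu mulr1.
have kd : k * d < d by rewrite gtr_pMl.
split.
- apply/eqP => yz; move: dotE; rewrite yz subrr -(scale0r u) dotvZl mul0r; lra.
- by rewrite dotE; lra.
- have nyz : enorm (y - z) <= d * (1 + k).
    rewrite yzE; apply: le_trans (enormD _ _) _.
    rewrite enormZ u1 mulr1 gtr0_norm//; lra.
  rewrite dotE; apply: (@le_trans _ _ (d * (1 + k) * s)).
    by rewrite ler_pM2r.
  rewrite -mulrA ks; lra.
Qed.

(** At distance [d] from [z], a ball of the cone of radius [k d] is within distance
    [(2 + k) d] and contributes a multiple of [d^alpha], which is at least [1 / d]
    when [alpha <= -1] and [d <= 1]. *)
Lemma exterior_potential_blowup alpha z a : alpha <= -1 ->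
  exterior_cone_condition Omega z -> Omega z -> ~ interior Omega z ->
  \forall x' \near z, interior Omega x' -> a < fine (W alpha Omega x').
Proof.
move=> alpha1 [e [theta [h [u [e0 th h0 u1 cone]]]]] Oz zO.
have alpha0 : alpha < 0 by apply: le_lt_trans alpha1 _; rewrite oppr_lt0.
have [k /andP[k0 k1] kB] := cone_balls z h th u1.
pose C := (2 + k) `^ (alpha - m%:R) * (kappa * k ^+ m).
have C0 : 0 < C by rewrite !mulr_gt0 ?powR_gt0 ?kappa_gt0 ?exprn_gt0// addr_gt0.
pose d0 := Num.min (Num.min 1 (h / 2)) (C / (`|a| + 1)).
have d00 : 0 < d0 by rewrite !lt_min ltr01 !divr_gt0//= ltr_wpDl.
near=> x' => x'O.
have dd : enorm (x' - z) < d0 by near: x'; exact: eball_nbhs.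
set d := enorm (x' - z) in dd.
have dpos : 0 < d.
  by apply: enorm_gt0; rewrite subr_eq0; apply/eqP => x'z; apply: zO; rewrite -x'z.
move: dd; rewrite !lt_min => /andP[/andP[d1 dh]] da.
have d2h : 2 * d <= h by move: dh; rewrite ltr_pdivlMr// mulrC => /ltW.
have eta0 : 0 < k * d by rewrite mulr_gt0.
have wO : eball (z + d *: u) (k * d) `<=` ~` Omega.
  by move=> y /(kB d dpos d2h) /cone[].
have x'O' : Omega x' := interior_subset x'O.
have x'r y : eball (z + d *: u) (k * d) y -> enorm (x' - y) <= (2 + k) * d.
  move=> yw; have yw' : enorm (z + d *: u - y) < k * d by rewrite enorm_sym.
  have zw : enorm (z - (z + d *: u)) = d.
    by rewrite opprD addrA subrr sub0r enormN enormZ u1 mulr1 gtr0_norm.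
  have := enorm_triangle x' z y; have := enorm_triangle z (z + d *: u) y.
  rewrite zw -/d; lra.
have := exterior_potential_ge clO alpha0 x'O' eta0 wO x'r.
rewrite -(fineK (exterior_potential_fin m2 clO alpha0 x'O)) lee_fin; apply: lt_le_trans.
have -> : ((2 + k) * d) `^ (alpha - m%:R) * (kappa * (k * d) ^+ m) = C * d `^ alpha.
  rewrite powRM ?ltW ?addr_gt0// exprMn -(powR_shift alpha m dpos) /C; ring.
apply: (@lt_le_trans _ _ (C * d^-1)).
  apply: le_lt_trans (ler_norm a) _; rewrite ltr_pdivlMr//.
  move: da; rewrite ltr_pdivlMr ?ltr_wpDl// => da; apply: le_lt_trans da.
  by rewrite mulrC ler_pM2l// lerDl.
have d01 : 0 < d <= 1 by rewrite dpos ltW.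
by rewrite ler_pM2l// -(powR_inv1 (ltW dpos)); exact: (ger_powR d01 alpha1).
Unshelve. all: end_near. Qed.

(** The exterior potential is lower semicontinuous in the interior and blows up at
    the boundary, hence attains its minimum. *)
Lemma center_exists alpha : alpha <= -1 -> interior Omega !=set0 ->
  (forall z, boundary Omega z -> exterior_cone_condition Omega z) ->
  centers alpha Omega !=set0.
Proof.
move=> alpha1 iO econe; have alpha0 : alpha < 0 by apply: le_lt_trans alpha1 _; rewrite oppr_lt0.
have lsc x : Omega x -> forall a, (interior Omega x -> a < fine (W alpha Omega x)) ->
    \forall x' \near x, interior Omega x' -> a < fine (W alpha Omega x').
  move=> Ox a aW; have [xO|xO] := pselect (interior Omega x).
    by have := exterior_potential_lsc alpha0 xO (aW xO); apply: filterS => x' + _.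
  apply: exterior_potential_blowup => //; apply: econe; split => //.
  exact: subset_closure.
have [x xO xmin] := lsc_attains_min cO (@interior_subset _ _) iO lsc.
exists x; right; split => [//|//|y yO].
rewrite (potential_exterior m2 clO alpha0 yO) (potential_exterior m2 clO alpha0 xO).
by rewrite lerN2; exact: xmin.
Qed.

(** The body outside a ball around [c] is compact and consists of points that are
    not max-min, so [not_maxmin_not_center] excludes centers from it for all
    [alpha] below one bound; inside the ball there is a center by
    [center_exists]. *)
Lemma hausdorff_centers_cvg c : interior Omega !=set0 ->
  (forall x, is_maxmin_point Omega x <-> x = c) ->
  (forall z, boundary Omega z -> exterior_cone_condition Omega z) ->
  hausdorff_dist (centers alpha Omega) [set c] @[alpha --> -oo] --> (0 : \bar R)%E.
Proof.
move=> iO cmaxmin econe.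
have near_c e : 0 < e -> \forall alpha \near -oo,
    (hausdorff_dist (centers alpha Omega) [set c] <= e%:E)%E.
  move=> e0.
  have cK : compact (Omega `\` eball c e).
    apply: (@subclosed_compact _ _ Omega) => //.
      by rewrite setDE; apply: closedI => //; apply: open_closedC; exact: open_eball.
  have far := (iffLR (compact_near_coveringP _) cK) R (-oo : set_system R)
    (fun alpha x => ~ is_center alpha Omega x) _.
  have {}far : \forall alpha \near -oo, Omega `\` eball c e `<=`
     (fun x => ~ is_center alpha Omega x).
    apply: far => x [_ xc]; apply: not_maxmin_not_center => //.
    by move=> /cmaxmin xE; apply: xc; rewrite xE; exact: eball_center.
  near=> alpha.
  have alpha1 : alpha <= -1.
    by near: alpha; apply: nbhs_ninfty_le; exact: num_real.
  have in_ball x : is_center alpha Omega x -> eball c e x.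
    move=> xc; apply: contrapT => xe.
    have Ox : Omega x.
      case: xc => [[+ _]|[_ xO _]]; last exact: interior_subset xO.
      by move=> malpha; have := ler0n R m; lra.
    have : (Omega `\` eball c e `<=` (fun x => ~ is_center alpha Omega x)).
      by near: alpha.
    by move=> /(_ x (conj Ox xe)).
  have [x xc] := center_exists alpha1 iO econe.
  apply: ereal_inf_lbound; exists e => //; split => //; split.
    by move=> y yc; exists c => //; exact: in_ball.
  move=> _ ->; exists x => //; rewrite /eball /= enorm_sym; exact: in_ball.
have ge0 alpha : (0 <= hausdorff_dist (centers alpha Omega) [set c])%E.
  by apply: le_ereal_inf_tmp => _ [e [e0 _] <-]; rewrite lee_fin ltW.
move=> A [e /= e0 eA].
have e20 : 0 < e / 2 by rewrite divr_gt0.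
apply: filterS (near_c _ e20) => alpha De.
have Dfin : hausdorff_dist (centers alpha Omega) [set c] \is a fin_num.
  by rewrite ge0_fin_numE ?ge0//; exact: le_lt_trans De (ltry _).
change (A (hausdorff_dist (centers alpha Omega) [set c])).
rewrite -(fineK Dfin); apply: (eA (fine _)) => /=.
rewrite sub0r normrN ger0_norm ?fine_ge0 ?ge0//.
by apply: (@le_lt_trans _ _ (e / 2)); [rewrite -lee_fin fineK|lra].
Unshelve. all: end_near. Qed.

End existence_negative.

(** * Convexity of powers and of the norm *)

Section power_inequalities.
Context {R : realType}.
Implicit Types (s t L p : R).

Lemma bernoulli_le (l : R) n : 0 <= l <= 1 -> 1 - n%:R * (1 - l) <= l ^+ n.
Proof.
move=> /andP[l0 l1]; elim: n => [|n IH]; first by rewrite mul0r subr0 expr0.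
rewrite exprS -natr1.
have n0 : 0 <= n%:R :> R by [].
apply: (@le_trans _ _ (l * (1 - n%:R * (1 - l)))); last by rewrite ler_wpM2l.
have : 0 <= n%:R * (1 - l) ^+ 2 by rewrite mulr_ge0// sqr_ge0.
nra.
Qed.

(** The optimal constant has [p] instead of [n]; with an integer above the exponent,
    Bernoulli's inequality applied to [s / t] suffices, also at [s = 0] where the
    power need not be differentiable. *)
Lemma powR_lipschitz s t L p n : 0 <= s -> s <= t -> t <= L -> 1 <= p -> p <= n%:R ->
  t `^ p - s `^ p <= n%:R * L `^ (p - 1) * (t - s).
Proof.
move=> s0 st tL p1 pn.
have p0 : 0 < p by apply: lt_le_trans p1.
have [t0|t0] := leP t 0.
  have -> : t = s by apply: le_anti; rewrite st (le_trans t0 s0).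
  by rewrite !subrr mulr0.
pose l := s / t.
have l0 : 0 <= l by rewrite divr_ge0// ltW.
have l1 : l <= 1 by rewrite ler_pdivrMr// mul1r.
have sE : s = l * t by rewrite divfK// gt_eqF.
have lp : 1 - n%:R * (1 - l) <= l `^ p.
  have [le0|lpos] := leP l 0.
    have -> : l = 0 by apply: le_anti; rewrite le0 l0.
    rewrite powR0 ?gt_eqF// subr0 mulr1 subr_le0; exact: le_trans pn.
  apply: le_trans (bernoulli_le n _) _; first by rewrite l0.
  by rewrite -powR_mulrn//; apply: ger_powR => //; rewrite lpos.
have tp : t `^ p = t * t `^ (p - 1) by rewrite mulr_powRB1// ltW.
have -> : s `^ p = l `^ p * t `^ p by rewrite {1}sE powRM// ltW.
apply: (@le_trans _ _ (n%:R * t `^ (p - 1) * (t - s))); last first.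
  rewrite ler_wpM2r ?subr_ge0// ler_wpM2l//; apply: ge0_ler_powR => //.
  - by rewrite subr_ge0.
  - by rewrite nnegrE ltW.
  - by rewrite nnegrE; apply: le_trans tL; exact: ltW.
have -> : n%:R * t `^ (p - 1) * (t - s) = n%:R * (1 - l) * t `^ p.
  by rewrite tp {1}sE; ring.
rewrite -{1}[t `^ p]mul1r -mulrBl; apply: ler_wpM2r; first exact: powR_ge0.
lra.
Qed.

Lemma powR_midpoint s t p : 0 <= s -> 0 <= t -> 1 <= p ->
  ((s + t) / 2) `^ p <= (s `^ p + t `^ p) / 2.
Proof.
move=> s0 t0 p1.
have h0 : 0 <= (2^-1 : R) by rewrite invr_ge0.
have h1 : (2^-1 : R) <= 1 by rewrite invf_le1// ler1n.
have := @convex_powR R p p1 (Itv01 h0 h1) s t; rewrite !inE /= !in_itv/= !andbT.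
move=> /(_ s0 t0); rewrite !convRE /= /unstable.onem => H.
rewrite -[conv _ _ _]/(2^-1 * s + (1 - 2^-1) * t) in H.
apply: le_trans (le_trans H _); last lra.
by rewrite le_eqVlt; apply/orP; left; apply/eqP; congr (_ `^ _); lra.
Qed.

Lemma powR_unbounded (b C : R) : 1 < b -> \forall p \near +oo, C < b `^ p.
Proof.
move=> b1; have lnb : 0 < ln b by rewrite ln_gt0.
near=> p; rewrite /powR gt_eqF ?(lt_trans _ b1)//.
apply: lt_le_trans (expR_ge1Dx _).
apply: (@lt_trans _ _ (p * ln b)); last by rewrite ltrDr.
rewrite -ltr_pdivrMr//; near: p; apply: nbhs_pinfty_gt; exact: num_real.
Unshelve. all: end_near. Qed.

End power_inequalities.

Section strict_triangle.
Context {R : realType} {m : nat}.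
Hypothesis m2 : (2 <= m)%N.
Implicit Types (x y a b w v : 'rV[R]_m).

(** Equality in the triangle inequality is equality in Cauchy-Schwarz, which makes
    [a] proportional to [b - a]. *)
Lemma enormD_lt a b : a != b -> (forall k, a <> k *: (b - a)) -> enorm (a + b) < enorm a + enorm b.
Proof.
move=> neq par; rewrite lt_neqAle enormD andbT; apply/eqP => E.
have ab : dotv a b = enorm a * enorm b.
  have : enorm (a + b) ^+ 2 = (enorm a + enorm b) ^+ 2 by rewrite E.
  rewrite sqrrD !sqr_enorm !dotvE (dotvC b a); lra.
have : enorm (enorm a *: b - enorm b *: a) ^+ 2 = 0.
  by rewrite cauchy_schwarz_defect ab subrr mulr0.
move/eqP; rewrite sqrf_eq0 => /eqP /enorm_eq0 /eqP; rewrite subr_eq0 => /eqP abE.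
have key : enorm a *: (b - a) = (enorm b - enorm a) *: a.
  by rewrite scalerBr scalerBl abE.
have [ba|ba] := eqVneq (enorm b - enorm a) 0.
  move: key; rewrite ba scale0r => /eqP; rewrite scaler_eq0 => /orP[/eqP/enorm_eq0 a0|/eqP a0].
    by apply: (par 0); rewrite scale0r.
  by move: neq; rewrite eq_sym -subr_eq0 a0 eqxx.
apply: (par (enorm a / (enorm b - enorm a))).
by rewrite mulrC -scalerA key scalerA mulVf// scale1r.
Qed.

(** Two vectors of the canonical basis cannot both be multiples of [w]. *)
Lemma not_parallel w : w != 0 -> exists2 v, enorm v = 1 & forall k, v <> k *: w.
Proof.
move=> w0; pose i := Ordinal (ltnW m2); pose j := Ordinal m2.
pose e (l : 'I_m) : 'rV[R]_m := delta_mx ord0 l.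
have e1 l : enorm (e l) = 1.
  rewrite /enorm /dotv (bigD1 l)//= big1 ?addr0 => [|l' l'l]; rewrite !mxE !eqxx.
    by rewrite mulr1 sqrtr1.
  by rewrite (negbTE l'l) mulr0.
have [[k ek]|ni] := pselect (exists k, e i = k *: w); last first.
  by exists (e i) => // k ek; apply: ni; exists k.
exists (e j) => // k' ek'.
have k0 : k != 0.
  apply/eqP => k0; have := congr1 (fun v : 'rV_m => v ord0 i) ek.
  by rewrite k0 scale0r !mxE !eqxx => /eqP; rewrite oner_eq0.
have wj : w ord0 j = 0.
  have := congr1 (fun v : 'rV_m => v ord0 j) ek; rewrite !mxE eqxx /=.
  by move=> /esym/eqP; rewrite mulf_eq0 (negbTE k0) => /eqP.
have := congr1 (fun v : 'rV_m => v ord0 j) ek'.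
by rewrite !mxE !eqxx wj mulr0 => /eqP; rewrite oner_eq0.
Qed.

(** If two nearby points of [O], differing by a vector [v] not parallel to [w], were
    both on the line, then [v] would be parallel to [w]. *)
Lemma off_line (O : set 'rV[R]_m) x w : open O -> O !=set0 -> w != 0 ->
  exists2 y, O y & forall k, y <> x + k *: w.
Proof.
move=> oO [y1 Oy1] w0; apply: contrapT => H.
have onl y : O y -> exists k, y = x + k *: w.
  move=> Oy; apply: contrapT => nk; apply: H; exists y => // k yk; apply: nk; by exists k.
have [v v1 vw] := not_parallel w0.
have [r r0 rO] := open_eballP oO Oy1.
have [k1 E1] := onl _ Oy1.
have [k2 E2] : exists k, y1 + (r / 2) *: v = x + k *: w.
  apply: onl; apply: rO; rewrite /eball /= addrAC subrr add0r enormZ v1 mulr1.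
  by rewrite gtr0_norm ?divr_gt0//; lra.
apply: (vw ((r / 2)^-1 * (k2 - k1))).
have : (r / 2) *: v = (k2 - k1) *: w.
  rewrite scalerBl; apply/esym/eqP; rewrite subr_eq; apply/eqP.
  by apply: (addrI x); rewrite -E2 E1 -addrA [k1 *: w + _]addrC.
by move=> E; rewrite -scalerA -E scalerA mulVf ?scale1r// gt_eqF// divr_gt0.
Qed.

End strict_triangle.

(** * Centers of positive order *)

Section positive_order.
Context {R : realType} {m : nat}.
Hypothesis m2 : (2 <= m)%N.
Local Notation mu := (@lebesgue_rV R m).
Local Notation kappa := (fine (@unit_ball_volume R m)).
Implicit Types (x y z c : 'rV[R]_m) (p alpha r a : R).
Variable Omega : set 'rV[R]_m.
Hypothesis cO : compact Omega.
Hypothesis Oint : Omega = closure (interior Omega).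
Hypothesis O0 : Omega !=set0.

Let clO : closed Omega.
Proof. by apply: compact_closed cO; exact: norm_hausdorff. Qed.

Let mO : borel Omega.
Proof. exact: closed_borel. Qed.

Lemma interior_nonempty : interior Omega !=set0.
Proof.
have [y] := O0; rewrite {1}Oint => /closure_eballP /(_ 1 ltr01)[z zO _].
by exists z.
Qed.

Let volume_lty : (mu Omega < +oo)%E.
Proof.
by have [M M0 OM] := compact_enorm_bounded cO; exact: bounded_volume_lty OM.
Qed.

Lemma integrable_kernel p x : 0 <= p ->
  mu.-integrable Omega (EFin \o (fun y => enorm (x - y) `^ p)).
Proof.
move=> p0; apply: measurable_bounded_integrable => //.
  apply/measurable_EFinP; exact: measurable_funS (measurable_kernel _ _).
have [M M0 OM] := compact_enorm_bounded cO.
exists ((enorm x + M) `^ p); split; first exact: num_real.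
move=> N xN y Oy /=; rewrite ger0_norm ?powR_ge0//; apply: le_trans (ltW xN).
apply: ge0_ler_powR => //; rewrite ?nnegrE ?enorm_ge0//.
  by rewrite addr_ge0 ?enorm_ge0// ltW.
apply: le_trans (enormD _ _) _; rewrite enormN lerD2l; exact: OM.
Qed.

Lemma potential_positive alpha x : 0 < alpha ->
  potential alpha Omega x = riesz_integral alpha Omega x.
Proof. by move=> alpha0; rewrite /potential alpha0. Qed.

Local Notation V := (riesz_integral (m := m)).

Lemma positive_centerP alpha x : m%:R < alpha ->
  is_center alpha Omega x <-> forall y, V alpha Omega x <= V alpha Omega y.
Proof.
move=> malpha; have alpha0 : 0 < alpha := le_lt_trans (ler0n R m) malpha.
have E y := potential_positive y alpha0.
split => [[[_ H] y|[neg _ _]]|H].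
- rewrite -(E x) -(E y); exact: H.
- by exfalso; have := lt_trans alpha0 neg; rewrite ltxx.
left; split => [//|y]; rewrite (E x) (E y); exact: H.
Qed.

Lemma riesz_integral_le alpha x r : m%:R <= alpha -> 0 <= r ->
  (forall y, Omega y -> enorm (x - y) <= r) ->
  V alpha Omega x <= r `^ (alpha - m%:R) * fine (mu Omega).
Proof.
move=> malpha r0 xr; have p0 : 0 <= alpha - m%:R by rewrite subr_ge0.
have Ic : mu.-integrable Omega (EFin \o cst (r `^ (alpha - m%:R))).
  by apply: (measurable_bounded_integrable mO) => //; exact: bounded_cst.
rewrite /riesz_integral -(Rintegral_cst mu mO).
apply: (le_Rintegral mO (integrable_kernel x p0) Ic).
- move=> y Oy; apply: ge0_ler_powR => //; rewrite ?nnegrE ?enorm_ge0//; exact: xr.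
Qed.

Lemma Rintegral_ge_eball (f : 'rV[R]_m -> R) w eta r :
  mu.-integrable Omega (EFin \o f) -> (forall y, Omega y -> 0 <= f y) ->
  0 <= r -> 0 < eta -> eball w eta `<=` Omega -> (forall y, eball w eta y -> r <= f y) ->
  r * (kappa * eta ^+ m) <= \int[mu]_(y in Omega) f y.
Proof.
move=> If f0 r0 eta0 wO wr.
have mB := eball_borel w eta.
have mf : measurable_fun (Omega : set (@borel_rV R m)) (EFin \o f) := measurable_int mu If.
rewrite -lee_fin /Rintegral (fineK (integrable_fin_num mO If)).
apply: (@le_trans _ _ (\int[mu]_(y in eball w eta) (f y)%:E)%E).
  rewrite EFinM -(eball_volume w eta0) -(integral_cst mu mB); apply: ge0_le_integral => //.
  by apply: measurable_funS mf.
by apply: ge0_subset_integral => // y Oy; rewrite lee_fin f0.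
Qed.

(** A pointwise inequality that is strict by a margin on a ball is strict after
    integration; stated for sums, as midpoint convexity uses it. *)
Lemma ltr_RintegralDD (f1 f2 h1 h2 : 'rV[R]_m -> R) w eta r :
  mu.-integrable Omega (EFin \o f1) -> mu.-integrable Omega (EFin \o f2) ->
  mu.-integrable Omega (EFin \o h1) -> mu.-integrable Omega (EFin \o h2) ->
  (forall y, Omega y -> h1 y + h2 y <= f1 y + f2 y) ->
  0 < r -> 0 < eta -> eball w eta `<=` Omega ->
  (forall y, eball w eta y -> r <= f1 y + f2 y - (h1 y + h2 y)) ->
  \int[mu]_(y in Omega) h1 y + \int[mu]_(y in Omega) h2 y <
  \int[mu]_(y in Omega) f1 y + \int[mu]_(y in Omega) f2 y.
Proof.
move=> If1 If2 Ih1 Ih2 hf r0 eta0 wO wr.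
have If := integrableD mO If1 If2; have Ih := integrableD mO Ih1 Ih2.
have Id := integrableB mO If Ih.
rewrite -(RintegralD mO If1 If2) -(RintegralD mO Ih1 Ih2) -subr_gt0.
rewrite -(RintegralB mO If Ih).
have := Rintegral_ge_eball Id _ (ltW r0) eta0 wO wr.
move=> H; apply: lt_le_trans (H _).
  by rewrite !mulr_gt0 ?kappa_gt0 ?exprn_gt0.
by move=> y Oy; rewrite subr_ge0 hf.
Qed.

Lemma riesz_integral_ge alpha x w eta r : m%:R <= alpha -> 0 <= r -> 0 < eta ->
  eball w eta `<=` Omega -> (forall y, eball w eta y -> r <= enorm (x - y)) ->
  r `^ (alpha - m%:R) * (kappa * eta ^+ m) <= V alpha Omega x.
Proof.
move=> malpha r0 eta0 wO wr; have p0 : 0 <= alpha - m%:R by rewrite subr_ge0.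
apply: (Rintegral_ge_eball (integrable_kernel x p0) _ _ eta0 wO).
- by move=> y _; exact: powR_ge0.
- exact: powR_ge0.
- move=> y wy; apply: ge0_ler_powR => //; rewrite ?nnegrE ?enorm_ge0//; exact: wr.
Qed.

(** The kernel decreases by at most a constant times [enorm (x' - x)], uniformly on
    the body, by [powR_lipschitz]. *)
Lemma riesz_integral_lsc alpha x a : m%:R + 1 <= alpha -> a < V alpha Omega x ->
  \forall x' \near x, a < V alpha Omega x'.
Proof.
move=> malpha aV.
have p1 : 1 <= alpha - m%:R by rewrite lerBrDl.
have p0 : 0 <= alpha - m%:R by exact: le_trans p1.
have [M M0 OM] := compact_enorm_bounded cO.
pose n := (Num.truncn (alpha - m%:R)).+1.
have pn : alpha - m%:R <= n%:R by rewrite ltW// truncnS_gt.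
pose L := enorm x + M.
pose C := n%:R * L `^ (alpha - m%:R - 1).
have C0 : 0 <= C by rewrite mulr_ge0// powR_ge0.
pose d := (V alpha Omega x - a) / (C * fine (mu Omega) + 1).
have vol0 : 0 <= fine (mu Omega) by rewrite fine_ge0.
have den0 : 0 < C * fine (mu Omega) + 1 by rewrite ltr_wpDl// mulr_ge0.
have d0 : 0 < d by rewrite divr_gt0// subr_gt0.
near=> x'.
have x'd : enorm (x' - x) < d by near: x'; exact: eball_nbhs.
have VV' : V alpha Omega x - V alpha Omega x' <= C * enorm (x' - x) * fine (mu Omega).
  rewrite /riesz_integral -RintegralB ?integrable_kernel// -Rintegral_cst//.
  apply: le_Rintegral => //.
  - exact: (integrableB mO (integrable_kernel x p0) (integrable_kernel x' p0)).
  - apply: measurable_bounded_integrable => //; exact: bounded_cst.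
  move=> y Oy; have [xy|xy] := leP (enorm (x - y)) (enorm (x' - y)).
    apply: (@le_trans _ _ 0); last by rewrite mulr_ge0 ?enorm_ge0.
    by rewrite subr_le0; apply: ge0_ler_powR => //; rewrite nnegrE enorm_ge0.
  apply: le_trans (@powR_lipschitz _ _ _ L _ n _ (ltW xy) _ p1 pn) _.
  - exact: enorm_ge0.
  - by apply: le_trans (enormD _ _) _; rewrite enormN lerD2l; exact: OM.
  rewrite ler_wpM2l//; have := enorm_triangle x x' y.
  rewrite (enorm_sym x x'); lra.
rewrite -ltrN2 -(ltrD2l (V alpha Omega x)); apply: le_lt_trans VV' _.
apply: (@le_lt_trans _ _ (C * d * fine (mu Omega))).
  by rewrite ler_wpM2r// ler_wpM2l// ltW.
by rewrite /d mulrAC mulrA ltr_pdivrMr// mulrC ltr_pM2l ?subr_gt0// ltrDl.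
Unshelve. all: end_near. Qed.

(** Outside the ball of radius [3 * M] every point of the body is farther than it is
    from the origin, so that the minimum over that ball is global. *)
Lemma positive_center_exists alpha M : m%:R + 1 <= alpha -> 0 < M ->
  (forall y, Omega y -> enorm y <= M) ->
  exists2 x, enorm x <= 3 * M & is_center alpha Omega x.
Proof.
move=> malpha M0 OM.
have p1 : 1 <= alpha - m%:R by rewrite lerBrDl.
have p0 : 0 <= alpha - m%:R by exact: le_trans p1.
pose K := [set x : 'rV[R]_m | enorm x <= 3 * M].
have cK : compact K by exact: compact_enorm_le.
have K0 : K 0 by rewrite /K /= enorm0 mulr_ge0// ltW.
have lsc x : K x -> forall a, (K x -> a < V alpha Omega x) ->
    \forall x' \near x, K x' -> a < V alpha Omega x'.
  by move=> Kx a /(_ Kx) aV; apply: filterS (riesz_integral_lsc malpha aV).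
have [x Kx xmin] := lsc_attains_min cK (@subset_refl _ _) (ex_intro _ _ K0) lsc.
have malpha' : m%:R < alpha by apply: lt_le_trans malpha; rewrite ltrDl.
exists x => //; apply/(positive_centerP _ malpha') => y.
have [Ky|Ky] := leP (enorm y) (3 * M); first exact: xmin.
(* [enorm (y - z) >= 2 * M >= enorm z] for [z] in the body *)
apply: le_trans (xmin 0 K0) _.
apply: (le_Rintegral mO (integrable_kernel _ p0) (integrable_kernel _ p0)) => z Oz.
 apply: ge0_ler_powR => //; rewrite ?nnegrE ?enorm_ge0//.
rewrite sub0r enormN; have := enormD (y - z) z; rewrite subrK; have := OM z Oz; lra.
Qed.

(** The kernel is convex in [x], and strictly so when [y] is off the line
    through the two points; in dimension at least two the interior of the body
    is not contained in that line. *)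
Lemma riesz_integral_strict_convex alpha x x' : m%:R + 1 <= alpha -> x != x' ->
  V alpha Omega (2^-1 *: (x + x')) + V alpha Omega (2^-1 *: (x + x')) <
  V alpha Omega x + V alpha Omega x'.
Proof.
move=> malpha xx'.
have p1 : 1 <= alpha - m%:R by rewrite lerBrDl.
have p0 : 0 <= alpha - m%:R by exact: le_trans p1.
set p := alpha - m%:R in p0 p1.
pose c := 2^-1 *: (x + x').
have w0 : x' - x != 0 by rewrite subr_eq0 eq_sym.
have [y0 Oy0 yline] := off_line m2 x (@open_interior _ Omega) interior_nonempty w0.
pose g y := (enorm (x - y) `^ p + enorm (x' - y) `^ p) / 2 - enorm (c - y) `^ p.
have cE y : enorm (c - y) = enorm ((x - y) + (x' - y)) / 2.
  rewrite (_ : c - y = 2^-1 *: ((x - y) + (x' - y))).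
    by rewrite enormZ ger0_norm ?invr_ge0// mulrC.
  by apply/rowP => i; rewrite !mxE; field.
have g0 y : 0 <= g y.
  rewrite subr_ge0; apply: le_trans (powR_midpoint (enorm_ge0 _) (enorm_ge0 _) p1).
  apply: ge0_ler_powR => //; rewrite ?nnegrE ?enorm_ge0 ?divr_ge0 ?addr_ge0 ?enorm_ge0//.
  by rewrite cE ler_pM2r ?invr_gt0// enormD.
have gy0 : 0 < g y0.
  rewrite subr_gt0; apply: lt_le_trans (powR_midpoint (enorm_ge0 _) (enorm_ge0 _) p1).
  apply: gt0_ltr_powR; rewrite ?nnegrE ?enorm_ge0 ?divr_ge0 ?addr_ge0 ?enorm_ge0//.
    exact: lt_le_trans p1.
  rewrite cE ltr_pM2r ?invr_gt0//; apply: enormD_lt.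
    by rewrite (inj_eq (addIr _)).
  move=> k; rewrite opprB addrA subrK => E; apply: (yline (- k)).
  by rewrite scaleNr -E opprB addrC subrK.
have cont z : y0 <> z -> {for y0, continuous (fun y => enorm (z - y) `^ p)}.
  move=> yz; rewrite (_ : (fun _ => _) = (fun y => enorm (y - z) `^ p)); last first.
    by apply/funext => y; rewrite enorm_sym.
  apply: (@continuous_comp _ _ _ (fun y => enorm (y - z)) (fun t => t `^ p)).
    exact: enormB_continuous.
  by apply: continuous_powR; apply: enorm_gt0; rewrite subr_eq0; exact/eqP.
have gcont : {for y0, continuous g}.
  have c1 : {for y0, continuous (fun y => enorm (x - y) `^ p)}.
    by apply: cont => E; apply: (yline 0); rewrite scale0r addr0.
  have c2 : {for y0, continuous (fun y => enorm (x' - y) `^ p)}.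
    by apply: cont => E; apply: (yline 1); rewrite scale1r addrC subrK.
  have c3 : {for y0, continuous (fun y => enorm (c - y) `^ p)}.
    apply: cont => E; apply: (yline 2^-1); rewrite E /c.
    by apply/rowP => i; rewrite !mxE; field.
  exact: (cvgB (cvgM (cvgD c1 c2) (cvg_cst _)) c3).
have g20 : g y0 / 2 < g y0 by lra.
have near_y0 : \forall y \near y0, Omega y /\ g y0 / 2 <= g y.
  near=> y; split; first by near: y.
  by apply: ltW; near: y; exact: (cvgr_gt (g y0) gcont).
have [eta eta0 etaO] := nbhs_eballP near_y0.
have avg y : enorm (x - y) `^ p + enorm (x' - y) `^ p -
    (enorm (c - y) `^ p + enorm (c - y) `^ p) = 2 * g y.
  rewrite /g; move: (enorm (x - y) `^ p) (enorm (x' - y) `^ p) (enorm (c - y) `^ p) => s t u.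
  by field.
have convex y : Omega y -> enorm (c - y) `^ p + enorm (c - y) `^ p <=
    enorm (x - y) `^ p + enorm (x' - y) `^ p.
  move=> _; rewrite -subr_ge0 (avg y); exact: (mulr_ge0 (ler0n R 2) (g0 y)).
have strict y : eball y0 eta y -> g y0 <= enorm (x - y) `^ p + enorm (x' - y) `^ p -
    (enorm (c - y) `^ p + enorm (c - y) `^ p).
  by move=> /etaO[_]; rewrite (avg y) (ler_pdivrMr _ _ (ltr0Sn R 1)) mulrC.
by apply: (ltr_RintegralDD (integrable_kernel x p0) (integrable_kernel x' p0)
  (integrable_kernel c p0) (integrable_kernel c p0) convex gy0 eta0 _ strict) => y /etaO[].
Unshelve. all: end_near. Qed.

Lemma positive_center_unique alpha x x' : m%:R + 1 <= alpha ->
  is_center alpha Omega x -> is_center alpha Omega x' -> x = x'.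
Proof.
move=> malpha; have malpha' : m%:R < alpha by apply: lt_le_trans malpha; rewrite ltrDl.
move=> /(positive_centerP _ malpha') cx /(positive_centerP _ malpha') cx'.
have [//|xx'] := eqVneq x x'; exfalso.
have := riesz_integral_strict_convex malpha xx'.
by apply/negP; rewrite -leNgt; apply: lerD; [exact: cx|exact: cx'].
Qed.

End positive_order.

(** * The min-max point as a limit of centers *)

Section minmax.
Context {R : realType} {m : nat}.
Implicit Types (x y z c : 'rV[R]_m) (p alpha r a : R).
Variable Omega : set 'rV[R]_m.
Hypothesis cO : compact Omega.
Hypothesis O0 : Omega !=set0.
Local Notation f := (max_dist Omega).

Let has_sup_dist x : has_sup [set enorm (y - x) | y in Omega].
Proof.
split; first by have [y Oy] := O0; exists (enorm (y - x)), y.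
have [M M0 OM] := compact_enorm_bounded cO; exists (M + enorm x) => _ [y Oy <-].
apply: le_trans (enormD _ _) _; rewrite enormN lerD2r; exact: OM.
Qed.

Lemma max_dist_ge x y : Omega y -> enorm (y - x) <= f x.
Proof. by move=> Oy; apply: (ub_le_sup (has_sup_dist x).2); exists y. Qed.

Lemma max_dist_le x r : (forall y, Omega y -> enorm (y - x) <= r) -> f x <= r.
Proof. by move=> H; apply: ge_sup; [exact: (has_sup_dist x).1|move=> _ [y Oy <-]; exact: H]. Qed.

Lemma max_dist_gt x r : r < f x -> exists2 y, Omega y & r < enorm (y - x).
Proof.
by move=> rf; have [_ [y Oy <-] ry] := sup_gt (has_sup_dist x).1 rf; exists y.
Qed.

Lemma max_dist_ge0 x : 0 <= f x.
Proof. by have [y Oy] := O0; apply: le_trans (enorm_ge0 _) (max_dist_ge x Oy). Qed.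

Lemma max_dist_lipschitz x x' : f x <= f x' + enorm (x' - x).
Proof.
apply: max_dist_le => y Oy; apply: le_trans (enorm_triangle y x' x) _.
by rewrite lerD2r max_dist_ge.
Qed.

(** The squared distance to each [y] is uniformly convex by the parallelogram law,
    with a modulus that does not depend on [y] and thus survives the supremum. *)
Lemma max_dist_midpoint x x' :
  f (2^-1 *: (x + x')) ^+ 2 <= (f x ^+ 2 + f x' ^+ 2) / 2 - enorm (x - x') ^+ 2 / 4.
Proof.
set c := 2^-1 *: (x + x'); set B := (X in _ <= X).
have bound y : Omega y -> enorm (y - c) ^+ 2 <= B.
  move=> Oy; rewrite parallelogram lerD2r ler_pM2r ?invr_gt0//.
  by apply: lerD; rewrite ler_sqr ?nnegrE ?enorm_ge0 ?max_dist_ge0// max_dist_ge.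
have B0 : 0 <= B by have [y /bound] := O0; apply: le_trans; exact: sqr_ge0.
have fB : f c <= Num.sqrt B.
  apply: max_dist_le => y /bound yB.
  by rewrite -[leLHS]ger0_norm ?enorm_ge0// -sqrtr_sqr ler_wsqrtr.
rewrite -[leRHS]sqr_sqrtr//; rewrite ler_sqr ?nnegrE ?max_dist_ge0 ?sqrtr_ge0//.
Qed.

Lemma minmax_point_exists : exists x, is_minmax_point Omega x.
Proof.
have [M M0 OM] := compact_enorm_bounded cO.
pose K := [set x : 'rV[R]_m | enorm x <= 3 * M].
have cK : compact K by exact: compact_enorm_le.
have K0 : K 0 by rewrite /K /= enorm0 mulr_ge0// ltW.
have lsc x : K x -> forall a, (K x -> a < f x) -> \forall x' \near x, K x' -> a < f x'.
  move=> Kx a /(_ Kx) af; near=> x' => _.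
  have x'x : enorm (x' - x) < f x - a by near: x'; apply: eball_nbhs; rewrite subr_gt0.
  have := max_dist_lipschitz x x'; lra.
have [x Kx xmin] := lsc_attains_min cK (@subset_refl _ _) (ex_intro _ _ K0) lsc.
exists x => y; have [Ky|Ky] := leP (enorm y) (3 * M); first exact: xmin.
apply: le_trans (xmin 0 K0) _; apply: max_dist_le => z Oz.
have := max_dist_ge y Oz; have := enormD (y - z) z; rewrite subrK (enorm_sym y z) subr0.
have := OM z Oz; lra.
Unshelve. all: end_near. Qed.

(** The midpoint of two distinct minimizers would do strictly better. *)
Lemma minmax_point_unique x x' : is_minmax_point Omega x -> is_minmax_point Omega x' -> x = x'.
Proof.
move=> mx mx'; apply/eqP; rewrite -subr_eq0; apply/eqP/enorm_eq0/eqP.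
rewrite -sqrf_eq0 eq_le sqr_ge0 andbT.
have := max_dist_midpoint x x'; set c := 2^-1 *: (x + x').
have sq z : is_minmax_point Omega z -> f z ^+ 2 <= f c ^+ 2.
  by move=> mz; rewrite ler_sqr ?nnegrE ?max_dist_ge0//; exact: mz.
have := sq _ mx; have := sq _ mx'; lra.
Qed.

End minmax.

Section positive_limit.
Context {R : realType} {m : nat}.
Hypothesis m2 : (2 <= m)%N.
Local Notation mu := (@lebesgue_rV R m).
Local Notation kappa := (fine (@unit_ball_volume R m)).
Implicit Types (x y z c : 'rV[R]_m) (p alpha r a : R).
Variable Omega : set 'rV[R]_m.
Hypothesis cO : compact Omega.
Hypothesis Oint : Omega = closure (interior Omega).
Hypothesis O0 : Omega !=set0.
Local Notation f := (max_dist Omega).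

Lemma interior_far_point x r : r < f x -> exists2 y, interior Omega y & r < enorm (y - x).
Proof.
move=> /(max_dist_gt cO O0)[y Oy ry].
have yclO : closure (interior Omega) y by rewrite -Oint.
have gap : 0 < enorm (y - x) - r by rewrite subr_gt0.
have [z zO zy] := (closure_eballP _ _).1 yclO _ gap.
exists z => //; have := enorm_triangle y z x; rewrite (enorm_sym y z); lra.
Qed.

(** If [c] is a point with [f c < f x], some ball of the body stays at distance [r]
    from every point near [x], with [r > s > f c].  There the potential is at least
    a constant times [r^(alpha - m)], while at [c] it is at most a constant times
    [s^(alpha - m)]. *)
Lemma not_minmax_not_center x : ~ is_minmax_point Omega x ->
  \forall x' \near x & alpha \near +oo, ~ is_center alpha Omega x'.
Proof.
move=> /existsNP[c /negP]; rewrite -ltNge => cx.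
(* Margins of size [q]: two separate [f c], [s] and [r]; two more cover the moving
   point and the radius of the ball; the last makes the choice of [w] strict. *)
pose q := (f x - f c) / 5.
have q0 : 0 < q by rewrite divr_gt0// subr_gt0.
have fc0 : 0 <= f c := max_dist_ge0 cO O0 c.
pose s := f c + q; have s0 : 0 < s by rewrite ltr_wpDl.
pose r := s + q; have sr : s < r by rewrite ltrDl.
have r0 : 0 < r := lt_trans s0 sr.
have [w wO wx] : exists2 w, interior Omega w & r + 2 * q < enorm (w - x).
  by apply: interior_far_point; rewrite /r /s /q; lra.
have [eta' eta'0 wO'] := nbhs_eballP wO.
pose eta := Num.min eta' q.
have eta0 : 0 < eta by rewrite lt_min eta'0.
have wOeta : eball w eta `<=` Omega.
  by move=> y wy; apply: wO'; apply: lt_le_trans wy _; rewrite /eta ge_min lexx.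
pose D : R := kappa * eta ^+ m.
have D0 : 0 < D by rewrite mulr_gt0 ?kappa_gt0 ?exprn_gt0.
have rs1 : 1 < r / s by rewrite ltr_pdivlMr// mul1r.
have [P [Preal HP]] := powR_unbounded (fine (mu Omega) / D) rs1.
near=> x' alpha => isc.
have malpha : m%:R < alpha.
  by near: alpha; apply: nbhs_pinfty_gt; exact: num_real.
have p_large : fine (mu Omega) / D < (r / s) `^ (alpha - m%:R).
  apply: HP; rewrite ltrBrDr; near: alpha; apply: nbhs_pinfty_gt; exact: num_real.
have x'x : enorm (x' - x) < q by near: x'; exact: eball_nbhs.
have far y : eball w eta y -> r <= enorm (x' - y).
  move=> wy; have wyq : enorm (y - w) < q.
    by apply: lt_le_trans wy _; rewrite /eta ge_min lexx orbT.
  have := enorm_triangle w x' x; have := enorm_triangle w y x'.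
  rewrite (enorm_sym w y) (enorm_sym y x'); lra.
have near_c y : Omega y -> enorm (c - y) <= s.
  move=> Oy; rewrite enorm_sym; apply: le_trans (max_dist_ge cO O0 c Oy) _.
  by rewrite /s lerDl ltW.
have lower := riesz_integral_ge cO (ltW malpha) (ltW r0) eta0 wOeta far.
have upper := riesz_integral_le cO (ltW malpha) (ltW s0) near_c.
have mid := (positive_centerP Omega x' malpha).1 isc c.
have := le_trans lower (le_trans mid upper).
apply/negP; rewrite -ltNge.
have rE : r = r / s * s by rewrite divfK// gt_eqF.
rewrite {1}rE powRM ?(ltW s0) ?divr_ge0 ?(ltW r0) ?(ltW s0)// -mulrA mulrCA.
rewrite ltr_pM2l ?powR_gt0//; move: p_large; rewrite ltr_pdivrMr//.
Unshelve. all: end_near. Qed.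

(** Centers of large order exist and are unique in a fixed compact ball;
    [not_minmax_not_center] excludes them from the part of it away from the min-max
    point, for all [alpha] above one bound. *)
Lemma positive_centers_converge :
  exists (c : R -> 'rV[R]_m) (cinf : 'rV[R]_m),
     [/\ forall alpha, m%:R + 1 <= alpha ->
           forall x, is_center alpha Omega x <-> x = c alpha,
         forall x, is_minmax_point Omega x <-> x = cinf &
         c alpha @[alpha --> +oo] --> cinf].
Proof.
have [M M0 OM] := compact_enorm_bounded cO.
have [cinf cinfP] := minmax_point_exists cO O0.
have /choice[c cP] : forall alpha, exists x, m%:R + 1 <= alpha ->
    enorm x <= 3 * M /\ is_center alpha Omega x.
  move=> alpha; have [malpha|malpha] := leP (m%:R + 1) alpha; last by exists 0.
  by have [x xM xc] := positive_center_exists cO malpha M0 OM; exists x.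
have cinfE x : is_minmax_point Omega x <-> x = cinf.
  by split => [xP|-> //]; exact: (minmax_point_unique cO O0).
exists c, cinf; split => //.
  move=> alpha malpha x; have [_ cc] := cP alpha malpha.
  split => [xc|-> //]; exact: (positive_center_unique m2 cO Oint O0 malpha).
apply: cvg_eballP => e e0.
have cK : compact ([set x | enorm x <= 3 * M] `\` eball cinf e).
  apply: (@subclosed_compact _ _ [set x | enorm x <= 3 * M]) => //.
  - rewrite setDE; apply: closedI; last by apply: open_closedC; exact: open_eball.
    by apply: compact_closed; [exact: norm_hausdorff|exact: compact_enorm_le].
  - exact: compact_enorm_le.
have far := (iffLR (compact_near_coveringP _) cK) R (+oo : set_system R)
  (fun alpha x => ~ is_center alpha Omega x) _.
have {}far : \forall alpha \near +oo, [set x | enorm x <= 3 * M] `\` eball cinf e `<=`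
   (fun x => ~ is_center alpha Omega x).
  apply: far => x [_ xc]; apply: not_minmax_not_center.
  by move=> /cinfE xE; apply: xc; rewrite xE; exact: eball_center.
near=> alpha.
have malpha : m%:R + 1 <= alpha.
  by near: alpha; apply: nbhs_pinfty_ge; exact: num_real.
have [cM cc] := cP alpha malpha.
apply: contrapT => ce.
have H : [set x | enorm x <= 3 * M] `\` eball cinf e `<=`
   (fun x => ~ is_center alpha Omega x) by near: alpha.
exact: (H (c alpha) (conj cM ce)).
Unshelve. all: end_near. Qed.

End positive_limit.

(** * Convergence of the centers *)

Theorem theorem3p23 (R : realType) (m : nat) (Omega : set 'rV[R]_m)
    (hm : (2 <= m)%N) (hbody : is_body Omega)
    (hC1 : piecewise_C1_boundary Omega) :
  (exists (c : R -> 'rV[R]_m) (cinf : 'rV[R]_m),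
     [/\ forall alpha, m%:R + 1 <= alpha ->
           forall x, is_center alpha Omega x <-> x = c alpha,
         forall x, is_minmax_point Omega x <-> x = cinf &
         c alpha @[alpha --> +oo] --> cinf]) /\
  (forall x, is_asymptotic_center Omega x -> is_maxmin_point Omega x) /\
  (forall cminf : 'rV[R]_m,
     (forall x, is_maxmin_point Omega x <-> x = cminf) ->
     (forall z, boundary Omega z -> exterior_cone_condition Omega z) ->
     hausdorff_dist (centers alpha Omega) [set cminf] @[alpha --> -oo]
       --> (0 : \bar R)%E).
Proof.
case: hbody => Onempty cO Oint.
split; first exact: positive_centers_converge.
split; first exact: asymptotic_center_maxmin.
move=> cminf cminfE econe; apply: hausdorff_centers_cvg => //.
exact: interior_nonempty.
Qed.
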